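(* Let $B_1$ and $B_2$ be connected building sets on $[n+1]$ with $B_1\subset B_2$ such that the nestohedra $P_{B_1}$ and $P_{B_2}$ are flag. Then $\gamma_i(P_{B_1})\le\gamma_i(P_{B_2})$ for all $i=0,\dots,\lfloor n/2\rfloor$.
   Context: Write $[m]=\{1,\dots,m\}$. A building set on $[n+1]$ is a collection $B$ of nonempty subsets of $[n+1]$ such that (i) $\{i\}\in B$ for all $i\in[n+1]$; (ii) if $S_1,S_2\in B$ and $S_1\cap S_2\ne\emptyset$ then $S_1\cup S_2\in B$. It is connected if $[n+1]\in B$. The nestohedron is the Minkowski sum $P_B=\sum_{S\in B}\Delta^S\subset\mathbb{R}^{n+1}$, where $\Delta^S=\operatorname{conv}\{e_i: i\in S\}$ and $e_1,\dots,e_{n+1}$ is the standard basis; for $B$ connected it is a simple $n$-dimensional polytope. A convex polytope is flag if any collection of pairwise intersecting facets has nonempty intersection. For a simple $n$-dimensional polytope $P$ let $f_i$ be the number of $i$-dimensional faces ($f_n=1$), and $h(P)(t)=\sum_{i=0}^n f_i(t-1)^i$. By the Dehn–Sommerville equations there are unique integers $\gamma_i=\gamma_i(P)$ with $h(P)(t)=\sum_{i=0}^{\lfloor n/2\rfloor}\gamma_i t^i(1+t)^{n-2i}$. *)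

(* Defs.v *)
From HB Require Import structures.
From mathcomp Require Import all_boot all_order all_algebra finmap.
From mathcomp Require Import boolp classical_sets cardinality reals convex.

Set Implicit Arguments.
Unset Strict Implicit.
Unset Printing Implicit Defensive.

Import Order.TTheory GRing.Theory Num.Theory.

Local Open Scope classical_set_scope.
Local Open Scope ring_scope.

(* The ground set [m] is represented by 'I_m, i.e. by {0, ..., m - 1}. *)
Definition building_set (m : nat) (B : {set {set 'I_m}}) : Prop :=
  [/\ (finset.set0 : {set 'I_m}) \notin B,
      forall i : 'I_m, [set i]%SET \in B
    & forall S1 S2 : {set 'I_m}, S1 \in B -> S2 \in B ->
        S1 :&: S2 != finset.set0 -> S1 :|: S2 \in B].

Definition connected_building_set (m : nat) (B : {set {set 'I_m}}) : Prop :=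
  building_set B /\ [set: 'I_m]%SET \in B.

Definition conv_hull (R : realType) (m : nat) (A : set 'rV[R]_m) :
    set 'rV[R]_m :=
  smallest (@convex_set R 'rV[R]_m) A.

Definition minkowski_sum (R : realType) (m : nat) (I : finType) (J : {set I})
    (A : I -> set 'rV[R]_m) : set 'rV[R]_m :=
  [set x | exists2 y : I -> 'rV[R]_m,
      forall i, i \in J -> A i (y i) & x = \sum_(i in J) y i].

Definition simplex (R : realType) (m : nat) (S : {set 'I_m}) : set 'rV[R]_m :=
  conv_hull [set (delta_mx 0 i : 'rV[R]_m) | i in [set i | i \in S]].

Definition nestohedron (R : realType) (m : nat) (B : {set {set 'I_m}}) :
    set 'rV[R]_m :=
  minkowski_sum B (@simplex R m).
Arguments nestohedron R {m} B.

(* A face is the nonempty intersection of P with a supporting hyperplane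
   c.x = b, or P itself, which is the case c = 0, b = 0.  The empty face is
   excluded: it does not enter the numbers f_i with i >= 0. *)
Definition is_face (R : realType) (m : nat) (P F : set 'rV[R]_m) : Prop :=
  F !=set0 /\
  exists (c : 'cV[R]_m) (b : R),
    (forall x, P x -> (x *m c) 0 0 <= b) /\
    F = [set x | P x /\ (x *m c) 0 0 = b].

(* Dimension of the affine hull of A, for A nonempty: the largest k such that
   A contains points x0, x0 + v1, ..., x0 + vk with v1, ..., vk linearly
   independent. *)
Definition affdim (R : realType) (m : nat) (A : set 'rV[R]_m) : nat :=
  \max_(k < m.+1 |
    `[< exists (x0 : 'rV[R]_m) (v : k.-tuple 'rV[R]_m),
          [/\ A x0, forall i : 'I_k, A (x0 + tnth v i) & free v] >]) k.

Definition is_facet (R : realType) (m : nat) (P F : set 'rV[R]_m) : Prop :=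
  is_face P F /\ (affdim F).+1 = affdim P.

Definition flag (R : realType) (m : nat) (P : set 'rV[R]_m) : Prop :=
  forall Fs : set (set 'rV[R]_m),
    (forall F, Fs F -> is_facet P F) ->
    (forall F G, Fs F -> Fs G -> F `&` G !=set0) ->
    \bigcap_(F in Fs) F !=set0.

(* fset_set returns the empty set on infinite sets, but a polytope has finitely
   many faces. *)
Definition face_number (R : realType) (m : nat) (P : set 'rV[R]_m) (i : nat) :
    nat :=
  #|` fset_set [set F : set 'rV[R]_m | is_face P F /\ affdim F = i]|%fset.

Definition h_poly (R : realType) (m : nat) (P : set 'rV[R]_m) : {poly int} :=
  \sum_(i < (affdim P).+1) ((face_number P i)%:R * ('X - 1) ^+ i).

(* g is extended by 0 beyond n./2, so that at most one g is valid. *)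
Definition is_gamma_vector (R : realType) (m : nat) (P : set 'rV[R]_m)
    (g : nat -> int) : Prop :=
  let n := affdim P in
  (forall i, (n./2 < i)%N -> g i = 0) /\
  h_poly P = \sum_(i < n./2.+1) (g i *: ('X ^+ i * (1 + 'X) ^+ (n - i.*2))).

Lemma is_gamma_vector_unique (R : realType) (m : nat) (P : set 'rV[R]_m)
    (g1 g2 : nat -> int) :
  is_gamma_vector P g1 -> is_gamma_vector P g2 -> g1 = g2.
Proof.
rewrite /is_gamma_vector; set n := affdim P => -[z1 ->] [z2 eqh].
apply/funext; elim/ltn_ind => k IHk.
have [kn|kn] := ltnP n./2 k; first by rewrite z1 // z2.
move: eqh => /(congr1 (fun p : {poly int} => p`_k)).
have coefk (g : nat -> int) :
  (\sum_(i < n./2.+1) (g i *: ('X ^+ i * (1 + 'X) ^+ (n - i.*2))))`_k =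
  \sum_(i < n./2.+1 | (i < k)%N)
     g i * ((1 + 'X) ^+ (n - i.*2) : {poly int})`_(k - i) + g k.
  have kn' : (k < n./2.+1)%N by [].
  rewrite coef_sum (bigID (fun i : 'I_(n./2.+1) => (i < k)%N)) /=.
  congr (_ + _).
    by apply: eq_bigr => i ik; rewrite coefZ coefXnM ltnNge (ltnW ik).
  rewrite (bigD1 (Ordinal kn')) /= -?leqNgt // big1 ?addr0.
    rewrite coefZ coefXnM ltnn subnn -horner_coef0 !hornerE /=.
    by rewrite ?addr0 expr1n mulr1.
  move=> i /andP[]; rewrite -leqNgt => ki /negP ik.
  rewrite coefZ coefXnM ltn_neqAle ki andbT.
  case: (eqVneq k i) => [e|_]; last by rewrite mulr0.
  by case: ik; apply/eqP/val_inj.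
rewrite !coefk (eq_bigr (fun i : 'I_(n./2.+1) =>
  g2 i * ((1 + 'X) ^+ (n - i.*2) : {poly int})`_(k - i))); first exact: addrI.
by move=> i ik; rewrite IHk.
Qed.

(* The gamma-vector of P, provided that h_poly P is palindromic, which the
   Dehn-Sommerville equations ensure for P simple (and 0 otherwise). *)
Definition gamma (R : realType) (m : nat) (P : set 'rV[R]_m) : nat -> int :=
  xget (fun=> 0) [set g | is_gamma_vector P g].

(* Main.v *)
From mathcomp Require Import finmap boolp classical_sets cardinality reals convex.
From mathcomp Require Import interval_inference.
From mathcomp Require Import all_boot all_order all_algebra.
From mathcomp Require Import ring zify.
Require Import Defs.

Set Implicit Arguments.
Unset Strict Implicit.
Unset Printing Implicit Defensive.

Import Order.TTheory GRing.Theory Num.Theory.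

(** A linear functional [c] attains its maximum over a Minkowski sum of
    simplices, one for each set [S] of a family [D], exactly on the sum of the
    faces spanned by the maximisers of [c] on the sets [S].  Two functionals
    cut out the same face if and only if they have the same maximisers on
    every [S] ([faceof_inj]), so the faces of the nestohedron are counted by
    the maps [S |-> argmax_S c].  The dimension of a face is the rank of the
    differences [e_i - e_j] with [i], [j] maximisers on a common [S]
    ([affdim_faceof]).  Hence the h-polynomial is the sum [hpol] of
    [(t - 1) ^ dim] over these maps ([h_poly_nestohedron]); this sum makes
    sense for every family of sets, and the rest of the argument on
    h-polynomials is combinatorial.

    Suppose that [C] belongs to [D] and contains every member of [D] that it
    meets.  A map whose value at [C] is [M] amounts to a map for the members of
    [D] that avoid [M]: a functional can be raised above all its other values on
    [M] and stays arbitrary elsewhere.  This is the recursion [hpol_rec].  Two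
    consequences carry the proof.  First, [hpol] is multiplicative for families
    with disjoint supports ([hpol_mul]).  Second, adding to a building set [D] a
    set [S] that is a disjoint union of members [S1], [S2] adds
    [t h(D|S1) h(D|S2) h(D/S)] ([hpol_add_set]): geometrically, when [S] is
    a proper subset of a member of [D], the new facet shaves off the face of
    codimension two where the facets of [S1] and [S2] meet, and this face is a
    product of three nestohedra.

    If the nestohedron is flag, then every member with at least two elements is
    a disjoint union of two members ([flag_splitting]): otherwise a maximal
    proper member of [S], together with the maximal members of its complement
    in [S], yields facets that meet pairwise but have no common point.
    When [B1] and [B2] have this splitting property, one passes from [B1] to
    [B2] by adding one set at a time, keeping a splitting building set
    ([exists_set_to_add]).  Every step adds [t] times a product of h-polynomials
    of splitting families on fewer elements.  These have nonnegative
    gamma-vectors by induction ([gammapos_hpol]); the induction starts from two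
    halves of the ground set, whose joint contribution is the factor [1 + t] of
    a segment.  The dimensions of the three factors add up to [n - 2], so the
    added term has a nonnegative gamma-vector for the dimension [n]. *)

Local Open Scope ring_scope.

(** * Maps of maximisers and the h-polynomial of a family of sets *)

Section ArgmaxMaps.
Variables (R : realFieldType) (m : nat).
Implicit Types (A C M S : {set 'I_m}) (D : {set {set 'I_m}}) (c : 'I_m -> R).
Implicit Types (phi psi : {ffun {set 'I_m} -> {set 'I_m}}).

(** The family left over once the maximum is known to be attained on [M]: every
    member that meets [M] has its maximisers in [M]. *)
Definition avoid D M := [set A in D | [disjoint A & M]]%SET.

Definition argmax c S := [set i in S | [forall j in S, c j <= c i]]%SET.

(** The value [set0] outside [D] makes the map, and hence its dimension, depend
    only on the behaviour of [c] on the members of [D]. *)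
Definition argmax_map c D : {ffun {set 'I_m} -> {set 'I_m}} :=
  [ffun S => if S \in D then argmax c S else set0].

Definition argmax_maps D := [set phi | `[< exists c, phi = argmax_map c D >]]%SET.

(** The direction space of the simplex on [A]. *)
Definition dirs A : {vspace 'rV[R]_m} :=
  <<[seq (delta_mx 0 i - delta_mx 0 j)%R | i <- enum A, j <- enum A]>>%VS.

Definition cdim phi := \dim (\sum_S dirs (phi S))%VS.

Definition hpol D : {poly int} := \sum_(phi in argmax_maps D) ('X - 1) ^+ cdim phi.

Lemma argmaxP c S i :
  reflect (i \in S /\ {in S, forall j, c j <= c i}) (i \in argmax c S).
Proof.
rewrite inE; apply: (iffP andP) => -[iS H]; split=> //; first exact/forall_inP.
exact/forall_inP.
Qed.

Lemma argmax_sub c S : argmax c S \subset S.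
Proof. by apply/subsetP => i /argmaxP[]. Qed.

Lemma argmax_neq0 c S : S != set0 -> argmax c S != set0.
Proof.
case/set0Pn => i iS; apply/set0Pn.
by case: (Order.TotalTheory.arg_maxP c iS) => j jS H; exists j; apply/argmaxP.
Qed.

Lemma argmax_map_in c D S : S \in D -> argmax_map c D S = argmax c S.
Proof. by move=> SD; rewrite ffunE SD. Qed.

Lemma argmax_map_out c D S : S \notin D -> argmax_map c D S = set0.
Proof. by move=> SD; rewrite ffunE (negPf SD). Qed.

Lemma argmax_mapsP D phi :
  reflect (exists c, phi = argmax_map c D) (phi \in argmax_maps D).
Proof. by rewrite inE; apply: asboolP. Qed.

Lemma mem_argmax_maps c D : argmax_map c D \in argmax_maps D.
Proof. by apply/argmax_mapsP; exists c. Qed.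

(** Properties that define a subspace need to be checked on generators only;
    stated for [Prop] so that linear equations need not be packaged as linear
    maps. *)
Lemma memv_span_ind (vT : vectType R) (P : vT -> Prop) (X : seq vT) v :
  P 0 -> (forall a u w, P u -> P w -> P (a *: u + w)) ->
  {in X, forall x, P x} -> v \in <<X>>%VS -> P v.
Proof.
move=> P0 PL PX; elim: X PX v => [|x X IH] PX v.
  by rewrite span_nil memv0 => /eqP->.
rewrite span_cons => /memv_addP[_ /vlineP[a ->] [w wX ->]].
apply: PL; first by apply: PX; rewrite mem_head.
by apply: IH wX => y yX; apply: PX; rewrite inE yX orbT.
Qed.

Lemma delta_sub_dirs A i j : i \in A -> j \in A ->
  delta_mx 0 i - delta_mx 0 j \in dirs A.
Proof.
by move=> iA jA; apply/memv_span/allpairs_f; rewrite mem_enum.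
Qed.

Lemma sum_delta (i : 'I_m) : \sum_j (delta_mx 0 i : 'rV[R]_m) 0 j = 1.
Proof.
rewrite (bigD1 i) //= mxE !eqxx big1 ?addr0 // => j ji.
by rewrite mxE (negPf ji) andbF.
Qed.

(** The equations of the direction space: it is often easier to check support
    and coordinate sum than to write down a combination of generators. *)
Lemma dirsP A (v : 'rV[R]_m) :
  (v \in dirs A) <->
  (forall i, i \notin A -> v 0 i = 0) /\ \sum_i v 0 i = 0.
Proof.
split.
  apply: (memv_span_ind (P := fun v : 'rV[R]_m =>
    (forall i, i \notin A -> v 0 i = 0) /\ \sum_i v 0 i = 0)).
  - by split=> [i _|]; rewrite ?big1 // => *; rewrite mxE.
  - move=> a u w [u1 u2] [w1 w2]; split=> [i iA|].
      by rewrite !mxE u1 // w1 // mulr0 addr0.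
    under eq_bigr do rewrite 2!mxE.
    by rewrite big_split /= -mulr_sumr u2 w2 mulr0 addr0.
  - move=> _ /allpairsP[[i j] /= [+ + ->]]; rewrite !mem_enum => iA jA.
    split=> [k kA|].
      have kn x : x \in A -> (k == x) = false.
        by move=> xA; apply: contraNF kA => /eqP->.
      by rewrite !mxE !kn // !andbF subrr.
    under eq_bigr do rewrite mxE [X in _ + X]mxE.
    by rewrite sumrB !sum_delta subrr.
move=> [v0 v1].
have [A0|/set0Pn[a aA]] := eqVneq A set0.
  suff -> : v = 0 by rewrite mem0v.
  by apply/rowP => i; rewrite v0 ?mxE // A0 inE.
have -> : v = \sum_(i in A) v 0 i *: (delta_mx 0 i - delta_mx 0 a).
  under eq_bigr do rewrite scalerBr.
  have sA (V : zmodType) (F : 'I_m -> V) : (forall i, i \notin A -> F i = 0) ->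
      \sum_(i in A) F i = \sum_i F i.
    by move=> F0; rewrite [RHS](bigID (mem A)) /= [X in _ + X]big1 ?addr0.
  rewrite sA => [|i iA]; last by rewrite v0 // !scale0r subrr.
  by rewrite sumrB -scaler_suml v1 scale0r subr0 -row_sum_delta.
by apply: memv_suml => i iA; apply/memvZ/delta_sub_dirs.
Qed.

Lemma dirs_vanish A M v : [disjoint A & M] -> v \in dirs A ->
  forall i, i \in M -> v 0 i = 0.
Proof.
move=> dAM /dirsP[v0 _] i iM; apply: v0; apply: contraTN iM => iA.
by rewrite (disjointFr dAM).
Qed.

Lemma dirsS A C : A \subset C -> (dirs A <= dirs C)%VS.
Proof.
move=> AC; apply/subvP => v /dirsP[v0 v1]; apply/dirsP; split=> // i iC.
by apply: v0; apply: contra iC; apply: (subsetP AC).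
Qed.

Lemma dirs0 : dirs set0 = 0%VS.
Proof.
apply/eqP; rewrite -subv0; apply/subvP => v /dirsP[v0 _]; rewrite memv0.
by apply/eqP/rowP => i; rewrite v0 ?mxE // inE.
Qed.

(** Removing one element [a] of [A] drops exactly the line spanned by
    [e_a - e_b], which is detected by the coordinate [a]. *)
Lemma dim_dirs A : \dim (dirs A) = #|A|.-1.
Proof.
have [k] := ubnP #|A|; elim: k A => // k IH A; rewrite ltnS => Ak.
have [->|/set0Pn[a aA]] := eqVneq A set0.
  by rewrite dirs0 dimv0 cards0.
have [A1|/set0Pn[b bA]] := eqVneq (A :\ a)%SET set0.
  have -> : A = [set a]%SET by rewrite -(setD1K aA) A1 setU0.
  rewrite cards1; apply/eqP; rewrite dimv_eq0 -subv0; apply/subvP => v.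
  case/dirsP => v0; rewrite (bigD1 a) //= big1 ?addr0 => [v1|i ia]; last first.
    by rewrite v0 // inE.
  rewrite memv0; apply/eqP/rowP => i; rewrite mxE.
  by have [->|ia] := eqVneq i a; rewrite ?v1 // v0 // inE.
have dE : delta_mx 0 a - delta_mx 0 b \in dirs A.
  by apply: delta_sub_dirs => //; move: bA; rewrite inE => /andP[].
have av : (delta_mx 0 a - delta_mx 0 b : 'rV[R]_m) 0 a = 1.
  by move: bA; rewrite !inE !mxE !eqxx eq_sym => /andP[/negPf-> _]; rewrite subr0.
have -> : dirs A = (dirs (A :\ a)%SET + <[(delta_mx 0 a - delta_mx 0 b)%R]>)%VS.
  apply/eqP; rewrite eqEsubv subv_add dirsS ?subsetDl // -memvE dE !andbT.
  apply/subvP => v /[dup] vA /dirsP[v0 v1].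
  rewrite -(subrK (v 0 a *: (delta_mx 0 a - delta_mx 0 b)) v).
  apply: memv_add; last exact/memvZ/memv_line.
  have /dirsP[w0 w1] : v - v 0 a *: (delta_mx 0 a - delta_mx 0 b) \in dirs A.
    by rewrite memvB // memvZ.
  apply/dirsP; split=> // i; rewrite in_setD1 negb_and negbK.
  case/orP => [/eqP->|/w0 //].
  by rewrite mxE [X in _ + X]mxE [X in _ - X]mxE av mulr1 subrr.
rewrite dimv_disjoint_sum; last first.
  apply/eqP; rewrite -subv0; apply/subvP => v /memv_capP[/dirsP[v0 _]].
  case/vlineP => x vx; have : v 0 a = 0 by rewrite v0 // !inE eqxx.
  by rewrite vx mxE av mulr1 => ->; rewrite scale0r mem0v.
have cA := cardsD1 a A; rewrite aA add1n in cA.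
rewrite IH; last by rewrite -cA.
rewrite dim_vline (_ : _ != 0) ?cA /=; last first.
  by apply/eqP => e; move: av; rewrite e mxE => /eqP; rewrite eq_sym oner_eq0.
by rewrite addn1 prednK // card_gt0; apply/set0Pn; exists b.
Qed.

(** The maps are sorted by their value [M] at [C].  Below, [res] restricts a map
    to the members that avoid [M], and [ext] extends such a map by [S :&: M] on
    the members that meet [M]; these are inverse bijections.  The two kinds of
    members have directions with disjoint supports, so dimensions add. *)
Lemma hpol_rec D C : C \in D -> C != set0 ->
  {in D, forall A, ~~ [disjoint A & C] -> A \subset C} ->
  hpol D = \sum_(M : {set 'I_m} | (M \subset C) && (M != set0))
              ('X - 1) ^+ #|M|.-1 * hpol (avoid D M).
Proof.
move=> CD C0 Cabs.
pose res M phi : {ffun {set 'I_m} -> {set 'I_m}} :=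
  [ffun S => if S \in avoid D M then phi S else set0].
pose ext M psi : {ffun {set 'I_m} -> {set 'I_m}} :=
  [ffun S => if S \in D then if [disjoint S & M] then psi S else S :&: M
             else set0]%SET.
rewrite /hpol (partition_big (fun phi : {ffun {set 'I_m} -> {set 'I_m}} => phi C)
  (fun M : {set 'I_m} => (M \subset C) && (M != set0))) /=; last first.
  move=> _ /argmax_mapsP[c ->]; rewrite argmax_map_in //.
  by rewrite argmax_sub argmax_neq0.
apply: eq_bigr => M /andP[MC M0].
have res_choice c : res M (argmax_map c D) = argmax_map c (avoid D M).
  by apply/ffunP => S; rewrite !ffunE inE; case: (S \in D).
have ext_choice c : ext M (argmax_map c (avoid D M)) \in argmax_maps D.
  apply/argmax_mapsP.
  (* The constant exceeds every value of [c], so that [M] takes precedence. *)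
  exists (fun i => if i \in M then 1 + \sum_j `|c j| else c i).
  have cle i : c i < 1 + \sum_j `|c j|.
    rewrite (bigD1 i) //= addrA ltr_wpDr ?sumr_ge0 // ltr_pwDl //.
    exact: ler_norm.
  apply/ffunP => S; rewrite !ffunE inE; case: ifP => SD //=.
  apply/setP => i; have [dSM|ndSM] := boolP [disjoint S & M].
    have nM x : x \in S -> x \in M = false by move=> xS; rewrite (disjointFr dSM).
    rewrite SD /=; apply/argmaxP/argmaxP => -[iS H]; split=> // j jS.
      by rewrite !nM // H.
    by have := H j jS; rewrite !nM.
  rewrite inE; apply/andP/argmaxP.
    by case=> iS iM; split=> // j jS; rewrite iM; case: ifP => // _; apply/ltW.
  case=> iS H; split=> //; apply: contraNT ndSM => iM.
  rewrite -setI_eq0 -subset0; apply/subsetP => j; rewrite inE => /andP[jS jM].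
  by have := H j jS; rewrite jM (negPf iM) leNgt cle.
have extC psi : ext M psi C = M.
  rewrite ffunE CD ifF; first exact/setIidPr.
  by apply/negbTE; rewrite -setI_eq0 (setIidPr MC).
rewrite (reindex_onto (ext M) (res M)) /=; last first.
  move=> _ /andP[/argmax_mapsP[c ->]]; rewrite argmax_map_in // => /eqP cM.
  rewrite res_choice; apply/ffunP => S; rewrite !ffunE inE.
  case: (boolP (S \in D)) => SD //=.
  case: (boolP [disjoint S & M]) => //= dSM.
  apply/setP => i.
  (* Since [S] lies in [C] and meets [M], its maximisers are those of [C]. *)
  have SC : S \subset C.
    apply: Cabs => //; apply: contraNN dSM => dSC.
    by apply: disjointWr dSC.
  rewrite inE -cM; apply/andP/argmaxP => [[iS /argmaxP[iC H]]|[iS H]].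
    by split=> // j jS; apply: H; apply: (subsetP SC).
  split=> //; apply/argmaxP; split; first exact: (subsetP SC).
  move: dSM; rewrite -setI_eq0 => /set0Pn[k]; rewrite inE.
  case/andP=> kS; rewrite -cM => /argmaxP[kC Hk] j /Hk/le_trans; apply.
  exact: H.
rewrite big_distrr /=; apply: eq_big => [psi|psi].
  rewrite extC eqxx andbT; apply/idP/argmax_mapsP.
    by case/andP=> /argmax_mapsP[c ->] /eqP <-; exists c; rewrite res_choice.
  case=> c ->; rewrite ext_choice /=; apply/eqP.
  apply/ffunP => S; rewrite !ffunE !inE.
  by case: (S \in D) => //=; case: [disjoint S & M].
rewrite extC eqxx andbT => /andP[/argmax_mapsP[c cE] /eqP rpsi].
rewrite -exprD; congr (_ ^+ _); rewrite -dim_dirs /cdim -[in RHS]rpsi.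
have extS S : ext M psi S \subset S.
  rewrite cE ffunE; case: ifP => _; [exact: argmax_sub|exact: sub0set].
have resE S : res M (ext M psi) S =
  if S \in avoid D M then ext M psi S else set0 by rewrite ffunE.
have extM S : S \notin avoid D M -> ext M psi S \subset M.
  rewrite ffunE inE; case: (S \in D) => /=; last by rewrite sub0set.
  by move=> /negPf ->; rewrite subsetIr.
move: (extC psi) extS resE extM; move: (res M _) => rho.
move: (ext M psi) => phi phiC phiS rhoE phiM.
rewrite -dimv_disjoint_sum.
  congr (\dim _); apply/eqP; rewrite eqEsubv subv_add.
  apply/and3P; split.
  - apply/subv_sumP => S _; have [SD|SD] := boolP (S \in avoid D M).
      apply: subv_trans (addvSr _ _); apply: (sumv_sup S) => //.
      by rewrite rhoE SD.
    by apply: subv_trans (addvSl _ _); apply/dirsS/phiM.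
  - by apply: (sumv_sup C) => //; rewrite phiC.
  - apply/subv_sumP => S _; apply: (sumv_sup S) => //.
    by rewrite rhoE; case: ifP => // _; rewrite dirs0 sub0v.
apply/eqP; rewrite -subv0; apply/subvP => v /memv_capP[/dirsP[v0 _]].
move=> /memv_sumP[w wS vE]; rewrite memv0; apply/eqP/rowP => i; rewrite mxE.
have [iM|/v0 //] := boolP (i \in M).
rewrite vE summxE big1 // => S _.
have := wS S isT; rewrite rhoE inE; case: ifP => [/andP[_ dSM]|_].
  by move/(dirs_vanish (disjointWl (phiS S) dSM)); apply.
by rewrite dirs0 memv0 => /eqP->; rewrite mxE.
Qed.

End ArgmaxMaps.

(** * Building sets: restriction, contraction, adding one set *)

Section Building.
Variables (R : realFieldType) (m : nat).
Implicit Types (A C M S : {set 'I_m}) (D : {set {set 'I_m}}).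

Local Notation h := (hpol R).

(** There is no fixed ground set, as restriction and contraction change it; the
    ground set is implicitly the union of the members. *)
Definition building D := set0 \notin D /\
  {in D &, forall A1 A2, ~~ [disjoint A1 & A2] -> A1 :|: A2 \in D}.

Definition restr D S := [set A in D | A \subset S]%SET.

Definition contr D S := [set A :\: S | A in D & ~~ (A \subset S)]%SET.

Lemma avoid_set0 D : avoid D set0 = D.
Proof. by apply/setP => A; rewrite inE -setI_eq0 setI0 eqxx andbT. Qed.

Lemma avoid_proper D M C : C \in D -> M \subset C -> M != set0 ->
  (#|avoid D M| < #|D|)%N.
Proof.
move=> CD MC M0; apply: proper_card; apply/properP; split.
  by apply/subsetP => A; rewrite inE => /andP[].
by exists C; rewrite // inE CD /= -setI_eq0 (setIidPr MC).
Qed.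

Lemma building_avoid D M : building D -> building (avoid D M).
Proof.
move=> [D0 DU]; split; first by rewrite inE (negPf D0).
move=> A1 A2; rewrite !inE => /andP[A1D A1M] /andP[A2D A2M] A12.
by rewrite DU //= -setI_eq0 setIUl setU_eq0 !setI_eq0 A1M.
Qed.

Lemma building_restr D S : building D -> building (restr D S).
Proof.
move=> [D0 DU]; split; first by rewrite inE (negPf D0).
move=> A1 A2; rewrite !inE => /andP[A1D A1M] /andP[A2D A2M] A12.
by rewrite DU //= subUset A1M.
Qed.

Lemma contrP D S A :
  reflect (exists A', [/\ A' \in D, ~~ (A' \subset S) & A = A' :\: S])
          (A \in contr D S).
Proof.
apply: (iffP imsetP) => [[A' + ->]|[A' [A'D A'S ->]]].
  by rewrite inE => /andP[? ?]; exists A'.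
by exists A' => //; rewrite inE A'D.
Qed.

Lemma building_contr D S : building D -> building (contr D S).
Proof.
move=> [D0 DU]; split.
  by apply/contrP => -[A [_ + /esym/eqP]]; rewrite setD_eq0 => /negP.
move=> _ _ /contrP[A1 [A1D A1S ->]] /contrP[A2 [A2D A2S ->]] dA.
apply/contrP; exists (A1 :|: A2); split; last by rewrite setDUl.
  apply: DU => //; apply: contraNN dA => dA.
  by apply: disjointW dA; rewrite subsetDl.
by rewrite subUset negb_and A1S.
Qed.

Lemma mem_building_neq0 D A : building D -> A \in D -> A != set0.
Proof. by move=> [D0 _]; apply: contraTneq => ->. Qed.

(** A member of maximal cardinality contains every member it meets, since the
    union with any of these is again a member. *)
Lemma exists_absorbing D A0 : building D -> A0 \in D ->
  exists2 C, C \in D & {in D, forall A, ~~ [disjoint A & C] -> A \subset C}.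
Proof.
move=> [_ DU] A0D; case: (arg_maxnP (fun A : {set 'I_m} => #|A|) A0D) => C CD Cmax.
exists C => // A AD AC; have := Cmax _ (DU _ _ AD CD AC) => le.
have /eqP-> : C == A :|: C by rewrite eqEcard subsetUr.
exact: subsetUl.
Qed.

Lemma hpol_set0 : h (@finset.set0 {set 'I_m}) = 1.
Proof.
rewrite /hpol (big_pred1 [ffun=> set0]) => [|phi].
  by rewrite /cdim big1 ?dimv0 // => S _; rewrite ffunE dirs0.
apply/argmax_mapsP/eqP => [[c ->]|->]; last exists (fun=> 0).
  by apply/ffunP => S; rewrite !ffunE inE.
by apply/ffunP => S; rewrite !ffunE inE.
Qed.

Lemma hpol_single C : C != set0 -> (#|C| <= 1)%N -> h [set C]%SET = 1.
Proof.
move=> C0 C1; rewrite (@hpol_rec R m _ C) ?inE //; last first.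
  by move=> A; rewrite inE => /eqP->.
rewrite (big_pred1 C) => [|M]; last first.
  apply/andP/eqP => [[MC M0]|->]; last by rewrite subxx.
  apply/eqP; rewrite eqEcard MC (leq_trans C1) // card_gt0 //.
have -> : avoid [set C]%SET C = set0.
  apply/setP => A; rewrite !inE; case: eqP => // ->.
  by rewrite -setI_eq0 setIid (negPf C0).
have -> : #|C| = 1%N by apply/eqP; rewrite eqn_leq C1 card_gt0.
by rewrite hpol_set0 mulr1.
Qed.

(** The product formula for faces of a product, obtained by running the same
    recursion on [D1] in both sides. *)
Lemma hpol_mul D1 D2 : building D1 ->
  (forall A1 A2, A1 \in D1 -> A2 \in D2 -> [disjoint A1 & A2]) ->
  h (D1 :|: D2) = h D1 * h D2.
Proof.
have [k] := ubnP #|D1|; elim: k D1 => // k IH D1; rewrite ltnS => Dk bD1 D12.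
have [->|/set0Pn[A0 A0D]] := eqVneq D1 set0.
  by rewrite set0U hpol_set0 mul1r.
have [C CD Cabs] := exists_absorbing bD1 A0D.
have C0 := mem_building_neq0 bD1 CD.
rewrite (@hpol_rec R m _ C) ?inE ?CD //; last first.
  move=> A; rewrite inE => /orP[/Cabs //|AD2].
  by rewrite disjoint_sym D12.
rewrite (hpol_rec R CD) // mulr_suml; apply: eq_bigr => M /andP[MC M0].
rewrite -mulrA; congr (_ * _).
have -> : avoid (D1 :|: D2) M = avoid D1 M :|: D2.
  apply/setP => A; rewrite !inE.
  case AD2: (A \in D2); rewrite ?orbT ?orbF //=.
  by apply: disjointWr MC _; rewrite disjoint_sym D12.
apply: IH; last first.
- by move=> A1 A2; rewrite inE => /andP[? _]; apply: D12.
- exact: building_avoid.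
exact: leq_trans (avoid_proper CD MC M0) Dk.
Qed.

Lemma avoid_setU1 D S M : [disjoint S & M] -> avoid (S |: D) M = S |: avoid D M.
Proof.
by move=> dSM; apply/setP => A; rewrite !inE; case: eqP => // ->.
Qed.

Lemma avoid_setU1_meet D S M : ~~ [disjoint S & M] -> avoid (S |: D) M = avoid D M.
Proof.
move=> dSM; apply/setP => A; rewrite !inE; case: eqP => // ->.
by rewrite (negPf dSM) !andbF.
Qed.

Lemma restr_avoid D S M : [disjoint S & M] -> restr (avoid D M) S = restr D S.
Proof.
move=> dSM; apply/setP => A; rewrite !inE; case AS: (A \subset S); rewrite ?andbF //.
by rewrite (disjointWl AS dSM) andbT.
Qed.

(** For [M] disjoint from [S], contraction by [S] does not change which members
    meet [M]. *)
Lemma contr_avoid D S M : [disjoint S & M] -> contr (avoid D M) S = avoid (contr D S) M.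
Proof.
have dD A : [disjoint S & M] -> [disjoint A :\: S & M] = [disjoint A & M].
  move=> dSM; rewrite -!setI_eq0 setIDAC; apply/eqP/eqP => [|->]; last exact: set0D.
  move/eqP; rewrite setD_eq0 => AMS; apply/eqP; rewrite -subset0.
  by move: dSM; rewrite -setI_eq0 => /eqP <-; rewrite subsetI AMS subsetIr.
move=> dSM; apply/setP => A; apply/contrP/idP.
  move=> [A' [+ A'S ->]]; rewrite !inE => /andP[A'D A'M].
  rewrite dD // A'M andbT; apply/contrP; exists A'; split=> //.
rewrite inE => /andP[/contrP[A' [A'D A'S ->]]]; rewrite dD // => A'M.
by exists A'; rewrite inE A'D.
Qed.

(** Including [M = set0] in the recursion of [hpol_rec], with weight
    [(t - 1) ^ #|M|], turns the sum into a multiple of [hpol D]; in this form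
    the sums for [S1] and [S2] multiply to the sum for their union. *)
Lemma hpol_rec_full D C : C \in D -> C != set0 ->
  {in D, forall A, ~~ [disjoint A & C] -> A \subset C} ->
  \sum_(M : {set 'I_m} | M \subset C) ('X - 1) ^+ #|M| * h (avoid D M) =
    'X * h D.
Proof.
move=> CD C0 Cabs; rewrite (bigD1 set0) ?sub0set //= cards0 expr0 mul1r.
rewrite avoid_set0.
rewrite (eq_bigr (fun M => ('X - 1) * (('X - 1) ^+ #|M|.-1 * h (avoid D M)))).
  by rewrite -mulr_sumr -(hpol_rec R CD) //; ring.
move=> M /andP[_ M0]; rewrite mulrA -exprS prednK // card_gt0 //.
Qed.

(** The case where [S] joins two connected components [S1], [S2] of [D].  The
    family [D] splits as a product over [S1], [S2] and the members disjoint from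
    [S], the latter being the contraction; summing over the subsets of [S] gives
    [t ^ 2 h(D)], and comparison with the recursion for the new family yields
    the factor [1 + t], the h-polynomial of a segment. *)
Lemma hpol_add_absorbing D S S1 S2 : building D -> S \notin D ->
  S1 \in D -> S2 \in D -> [disjoint S1 & S2] -> S = S1 :|: S2 ->
  {in D, forall A, ~~ [disjoint A & S] -> A \subset S} ->
  h (S |: D) = h D + 'X * (h (restr D S1) * h (restr D S2) * h (contr D S)).
Proof.
move=> bD SD S1D S2D dS SE Sabs.
have [S1S S2S] : S1 \subset S /\ S2 \subset S by rewrite SE subsetUl subsetUr.
have S10 := mem_building_neq0 bD S1D.
have S20 := mem_building_neq0 bD S2D.
have meetS A T T' : A \in D -> T \in D -> T' \in D -> S = T :|: T' ->
    ~~ [disjoint A & T] -> A \subset T.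
  move=> AD TD T'D ST AT.
  have AS : A \subset S.
    apply: Sabs => //; apply: contraNN AT; apply: disjointWr.
    by rewrite ST subsetUl.
  have [dAT'|AT'] := boolP [disjoint A & T'].
    apply/subsetP => i iA; have := subsetP AS i iA; rewrite ST inE.
    by rewrite (disjointFr dAT') // orbF.
  have ATD := bD.2 _ _ AD TD AT.
  case/negP: SD; suff -> : S = (A :|: T) :|: T'.
    apply: bD.2 => //; apply: contraNN AT'; apply: disjointWl.
    exact: subsetUl.
  by rewrite -setUA -ST; apply/esym/setUidPr.
have iso T : {in restr D T, forall A, ~~ [disjoint A & T] -> A \subset T}.
  by move=> A; rewrite inE => /andP[].
(* No member meets both [S1] and [S2], because [S] is not a member of [D]. *)
have DE M : M \subset S -> avoid D M =
    avoid (restr D S1) (M :&: S1) :|: (avoid (restr D S2) (M :&: S2) :|: contr D S).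
  move=> MS; apply/setP => A.
  have dW (T : {set 'I_m}) : A \subset T -> [disjoint A & M] = [disjoint A & M :&: T].
    by move=> AT; rewrite -!setI_eq0 setIA -setIAC (setIidPl AT).
  rewrite !in_setU ![in RHS]inE; apply/idP/idP.
    rewrite inE => /andP[AD AM].
    have [AS|AS] := boolP [disjoint A & S].
      apply/orP; right; apply/orP; right; apply/contrP; exists A; split=> //.
        apply: contraTN AS => AS; rewrite -setI_eq0 (setIidPl AS).
        exact: mem_building_neq0 AD.
      by apply/esym/setDidPl.
    have [dA1|dA1] := boolP [disjoint A & S1].
      have dA2 : ~~ [disjoint A & S2].
        apply: contraNN AS => dA2.
        by rewrite SE -setI_eq0 setIUr setU_eq0 !setI_eq0 dA1.
      have AS2 := meetS _ _ _ AD S2D S1D (etrans SE (setUC _ _)) dA2.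
      by rewrite AD AS2 -(dW S2) // AM orbT.
    have AS1 := meetS _ _ _ AD S1D S2D SE dA1.
    by rewrite AD AS1 -(dW S1) // AM.
  rewrite inE; case/or3P.
  - by move=> /andP[/andP[-> AS1]]; rewrite -dW.
  - by move=> /andP[/andP[-> AS1]]; rewrite -dW.
  case/contrP => A' [A'D A'S ->].
  have dA' : [disjoint A' & S] by apply: contraNT A'S => /Sabs; apply.
  by rewrite (setDidPl dA') A'D (disjointWr MS).
have hDE M : M \subset S -> h (avoid D M) =
    h (avoid (restr D S1) (M :&: S1)) * h (avoid (restr D S2) (M :&: S2)) *
    h (contr D S).
  move=> MS; rewrite DE // -mulrA !hpol_mul //.
  - exact/building_avoid/building_restr.
  - move=> A1 A2; rewrite !inE => /andP[/andP[_ A1S] _] /contrP[A' [_ _ ->]].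
    apply: disjointWl (subset_trans A1S S2S) _.
    by rewrite -setI_eq0 setDE setICA setICr setI0.
  - exact/building_avoid/building_restr.
  - move=> A1 A2; rewrite !inE => /andP[/andP[_ A1S] _] /orP[/andP[/andP[_ A2S] _]|].
      exact: disjointW dS.
    move=> /contrP[A' [_ _ ->]].
    apply: disjointWl (subset_trans A1S S1S) _.
    by rewrite -setI_eq0 setDE setICA setICr setI0.
have S0 : S != set0 by apply: contraNneq S10 => S0; rewrite -subset0 -S0.
have hD : h D = h (restr D S1) * h (restr D S2) * h (contr D S).
  by have := hDE set0 (sub0set _); rewrite !set0I !avoid_set0.
have S1r : S1 \in restr D S1 by rewrite inE S1D /=.
have S2r : S2 \in restr D S2 by rewrite inE S2D /=.
have sumD : \sum_(M : {set 'I_m} | M \subset S) ('X - 1) ^+ #|M| * h (avoid D M)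
    = 'X ^+ 2 * h D.
  rewrite hD expr2 -mulrA.
  transitivity (('X * h (restr D S1)) * ('X * h (restr D S2)) * h (contr D S));
    last by ring.
  rewrite -(hpol_rec_full S1r) // -(hpol_rec_full S2r) //.
  rewrite big_distrlr /= pair_big /= mulr_suml.
  rewrite (reindex_onto (fun p : {set 'I_m} * {set 'I_m} => p.1 :|: p.2)
     (fun M => (M :&: S1, M :&: S2))) /=; last first.
    by move=> M MS; rewrite -setIUr -SE; apply/setIidPl.
  have pE (M1 M2 : {set 'I_m}) : M1 \subset S1 -> M2 \subset S2 ->
      ((M1 :|: M2) :&: S1, (M1 :|: M2) :&: S2) = (M1, M2).
    move=> M1S M2S; rewrite !setIUl (setIidPl M1S) (setIidPl M2S).
    have /eqP -> : M2 :&: S1 == set0.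
      by rewrite setI_eq0 disjoint_sym; apply: disjointWr dS.
    have /eqP -> : M1 :&: S2 == set0 by rewrite setI_eq0; apply: disjointWl dS.
    by rewrite setU0 set0U.
  apply: eq_big => [[M1 M2]|[M1 M2] /=] /=.
    apply/andP/andP => [[_ /eqP[<- <-]]|[M1S M2S]]; first by rewrite !subsetIr.
    by rewrite pE // eqxx SE setUSS.
  case/andP=> MS /eqP[e1 e2]; rewrite hDE // e1 e2 cardsU.
  have -> : M1 :&: M2 = set0.
    by apply/eqP; rewrite setI_eq0 -e1 -e2; apply: disjointW dS; apply: subsetIr.
  by rewrite cards0 subn0 exprD; ring.
have X1 : 'X - 1 != 0 :> {poly int} by rewrite -polyC1 polyXsubC_eq0.
apply: (mulfI X1); rewrite -hD.
have := hpol_rec_full (setU11 S D) S0.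
rewrite (bigD1 set0) ?sub0set //= cards0 expr0 mul1r avoid_set0.
move: sumD; rewrite (bigD1 set0) ?sub0set //= cards0 expr0 mul1r avoid_set0.
rewrite [X in h (_ |: _) + X](eq_bigr (fun M => ('X - 1) ^+ #|M| * h (avoid D M))).
  move: (\sum_(_ | _) _) => s sE rec.
  have {}rec : 'X * h (S |: D) = h (S |: D) + s.
    rewrite rec // => A; rewrite !inE => /orP[/eqP->|]; [by rewrite subxx|exact: Sabs].
  have se : s = 'X ^+ 2 * h D - h D by rewrite -sE; ring.
  by rewrite mulrBl rec mul1r se; ring.
move=> M /andP[MS M0]; rewrite avoid_setU1_meet //.
by rewrite -setI_eq0 (setIidPr MS).
Qed.

(** The effect of shaving off a face of codimension two.  Induction on [D]
    through [hpol_rec] at a member [C] that absorbs all it meets.  Only the sets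
    [M] disjoint from [S] see the difference between the two families.  If [C]
    is disjoint from [S], it plays the same role in the contraction; if [C]
    strictly contains [S], these [M] are the subsets of [C :\: S], which is the
    member of the contraction to expand along. *)
Lemma hpol_add_set D S S1 S2 : building D -> building (S |: D) -> S \notin D ->
  S1 \in D -> S2 \in D -> [disjoint S1 & S2] -> S = S1 :|: S2 ->
  h (S |: D) = h D + 'X * (h (restr D S1) * h (restr D S2) * h (contr D S)).
Proof.
have [k] := ubnP #|D|; elim: k D => // k IH D; rewrite ltnS => Dk.
move=> bD bD' SD S1D S2D dS SE.
have [S1S S2S] : S1 \subset S /\ S2 \subset S by rewrite SE subsetUl subsetUr.
have S10 := mem_building_neq0 bD S1D.
have S20 := mem_building_neq0 bD S2D.
have IHM C M : C \in D -> M \subset C -> M != set0 -> [disjoint S & M] ->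
  h (avoid (S |: D) M) = h (avoid D M) +
    'X * (h (restr D S1) * h (restr D S2)) * h (avoid (contr D S) M).
  move=> CD MC M0 dSM; rewrite avoid_setU1 // IH.
  - rewrite !restr_avoid ?contr_avoid ?mulrA //;
      exact: disjointWl dSM.
  - exact: leq_trans (avoid_proper CD MC M0) Dk.
  - exact: building_avoid.
  - by rewrite -avoid_setU1 //; apply: building_avoid.
  - by rewrite inE (negPf SD).
  - by rewrite inE S1D (disjointWl S1S).
  - by rewrite inE S2D (disjointWl S2S).
  - by [].
  - by [].
have [C CD' Cabs] := exists_absorbing bD' (setU11 S D).
have [CS|CS] := eqVneq C S.
  subst C; apply: hpol_add_absorbing => // A AD; apply: Cabs.
  by rewrite inE AD orbT.
have CD : C \in D by move: CD'; rewrite !inE (negPf CS).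
have C0 := mem_building_neq0 bD CD.
have absD : {in D, forall A, ~~ [disjoint A & C] -> A \subset C}.
  by move=> A AD; apply: Cabs; rewrite inE AD orbT.
rewrite (hpol_rec R CD') // [h D](hpol_rec R CD) // mulrA.
have [dSC|mSC] := boolP [disjoint S & C].
  have Cc : C \in contr D S.
    apply/contrP; exists C; split=> //.
      apply: contraNN C0 => CsubS; rewrite -subset0.
      by move: dSC; rewrite -setI_eq0 => /eqP <-; rewrite subsetI CsubS subxx.
    by apply/esym/setDidPl; rewrite disjoint_sym.
  rewrite (hpol_rec R Cc) //; last first.
    move=> _ /contrP[A [AD AS ->]] dA; apply: subset_trans (subsetDl _ _) _.
    apply: absD => //; apply: contraNN dA => dA.
    by apply: disjointWl dA; apply: subsetDl.
  rewrite mulr_sumr -big_split /=; apply: eq_bigr => M /andP[MC M0].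
  rewrite (IHM C) //; last exact: disjointWr dSC.
  by ring.
have SC : S \subset C by apply: Cabs; rewrite ?setU11.
have CDc : C :\: S \in contr D S.
  apply/contrP; exists C; split=> //.
  by apply: contraNN CS => CS; rewrite eqEsubset CS.
have CS0 := mem_building_neq0 (building_contr S bD) CDc.
rewrite (hpol_rec R CDc) //; last first.
  move=> _ /contrP[A [AD AS ->]] dA; apply: setSD; apply: absD => //.
  by apply: contraNN dA => dA; apply: disjointW dA; apply: subsetDl.
rewrite mulr_sumr.
rewrite (eq_bigr (fun M => ('X - 1) ^+ #|M|.-1 * h (avoid D M) +
  if [disjoint S & M] then 'X * (h (restr D S1) * h (restr D S2)) *
     (('X - 1) ^+ #|M|.-1 * h (avoid (contr D S) M)) else 0)); last first.
  move=> M /andP[MC M0]; case: ifPn => dSM; last by rewrite addr0 avoid_setU1_meet.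
  by rewrite (IHM C) //; ring.
rewrite big_split /= -big_mkcondr; congr (_ + _); apply: eq_bigl => M.
by rewrite subsetD disjoint_sym -!andbA; congr (_ && _); rewrite andbC.
Qed.

End Building.

(** * Polynomials with nonnegative gamma-vector *)

Section GammaNonneg.
Implicit Types (d i : nat) (p q : {poly int}).

Definition gammapos d p := exists g : nat -> int,
  [/\ forall i, 0 <= g i, forall i, (d./2 < i)%N -> g i = 0 &
      p = \sum_(i < d./2.+1) (g i *: ('X ^+ i * (1 + 'X) ^+ (d - i.*2)))].

Lemma gammapos0 d : gammapos d 0.
Proof.
by exists (fun=> 0); split=> //; rewrite big1 // => i _; rewrite scale0r.
Qed.

Lemma gammaposD d p q : gammapos d p -> gammapos d q -> gammapos d (p + q).
Proof.
move=> [g [g0 gd ->]] [g' [g'0 g'd ->]]; exists (fun i => g i + g' i); split.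
- by move=> i; rewrite addr_ge0.
- by move=> i di; rewrite gd ?g'd // addr0.
by rewrite -big_split; apply: eq_bigr => i _; rewrite scalerDl.
Qed.

Lemma gammapos_term d i (a : int) : 0 <= a -> (i <= d./2)%N ->
  gammapos d (a *: ('X ^+ i * (1 + 'X) ^+ (d - i.*2))).
Proof.
move=> a0 id; exists (fun j => if j == i then a else 0); split.
- by move=> j; case: ifP.
- by move=> j dj; case: eqP => // ji; move: dj; rewrite ji ltnNge id.
rewrite (bigD1 (Ordinal (id : (i < d./2.+1)%N))) //= eqxx big1 ?addr0 //.
by move=> j; rewrite -val_eqE /= => /negPf->; rewrite scale0r.
Qed.

Lemma gammaposM d e p q : gammapos d p -> gammapos e q -> gammapos (d + e) (p * q).
Proof.
move=> [g [g0 _ ->]] [g' [g'0 _ ->]]; rewrite big_distrlr /=.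
have gsum := big_ind (gammapos (d + e)) (gammapos0 _) (@gammaposD _).
apply: (gsum _ _ _ _) => i _; apply: (gsum _ _ _ _) => j _.
have id : (i <= d./2)%N by rewrite -ltnS.
have je : (j <= e./2)%N by rewrite -ltnS.
have -> : g i *: ('X ^+ i * (1 + 'X) ^+ (d - i.*2)) *
          (g' j *: ('X ^+ j * (1 + 'X) ^+ (e - j.*2))) =
   (g i * g' j) *: ('X ^+ (i + j) * (1 + 'X) ^+ (d + e - (i + j).*2)) :> {poly int}.
  rewrite -scalerAl -scalerAr scalerA.
  have -> : (d + e - (i + j).*2 = (d - i.*2) + (e - j.*2))%N by lia.
  by rewrite !exprD; congr (_ *: _); ring.
by apply: gammapos_term; [rewrite mulr_ge0|lia].
Qed.

Lemma gammapos1 : gammapos 0 1.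
Proof.
by rewrite -(scale1r 1) -[1 in X in _ *: X](mulr1 1); apply: (@gammapos_term 0 0).
Qed.

Lemma gammaposX : gammapos 2 'X.
Proof.
have -> : 'X = 1 *: ('X ^+ 1 * (1 + 'X) ^+ (2 - 1.*2)) :> {poly int}.
  by rewrite scale1r expr1 subnn expr0 mulr1.
exact: gammapos_term.
Qed.

Lemma gammapos1X : gammapos 1 (1 + 'X).
Proof.
have -> : 1 + 'X = 1 *: ('X ^+ 0 * (1 + 'X) ^+ (1 - 0.*2)) :> {poly int}.
  by rewrite scale1r expr0 mul1r expr1.
exact: gammapos_term.
Qed.

End GammaNonneg.

Lemma pred_add2 a b : (0 < a)%N -> (0 < b)%N ->
  (a + b).-1 = (1 + (a.-1 + b.-1))%N.
Proof. lia. Qed.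

Lemma pred_add3 a b c : (0 < a)%N -> (0 < b)%N -> (0 < c)%N ->
  (a + b + c).-1 = (2 + (a.-1 + b.-1 + c.-1))%N.
Proof. lia. Qed.

(** * Splitting building sets *)

Section Flag.
Variables (R : realFieldType) (m : nat).
Implicit Types (A C M S : {set 'I_m}) (D : {set {set 'I_m}}).

Local Notation h := (hpol R).

(** The combinatorial form of flagness, inherited by restrictions and
    contractions. *)
Definition splitting D := {in D, forall A, (1 < #|A|)%N ->
  exists A1 A2, [/\ A1 \in D, A2 \in D, [disjoint A1 & A2] & A = A1 :|: A2]}.

Definition top D C := C \in D /\ {in D, forall A, A \subset C}.

Lemma splitting_restr D S : splitting D -> splitting (restr D S).
Proof.
move=> sD A; rewrite inE => /andP[AD AS] A1.
have [A1' [A2 [A1D A2D dA AE]]] := sD A AD A1; exists A1', A2; split=> //.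
  by rewrite inE A1D (subset_trans _ AS) // AE subsetUl.
by rewrite inE A2D (subset_trans _ AS) // AE subsetUr.
Qed.

Lemma cards_disjointU A1 A2 :
  [disjoint A1 & A2] -> #|A1 :|: A2| = (#|A1| + #|A2|)%N.
Proof. by rewrite -setI_eq0 cardsU => /eqP->; rewrite cards0 subn0. Qed.

Lemma split_card_lt D A A1 A2 : building D -> A1 \in D -> A2 \in D ->
  [disjoint A1 & A2] -> A = A1 :|: A2 -> (#|A1| < #|A|)%N && (#|A2| < #|A|)%N.
Proof.
move=> bD A1D A2D dA ->; rewrite cards_disjointU //.
rewrite -addn1 leq_add2l card_gt0 (mem_building_neq0 bD A2D) /=.
by rewrite -add1n leq_add2r card_gt0 (mem_building_neq0 bD A1D).
Qed.

(** When one of the two parts of [A] lies in [S], the other one has the same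
    trace outside [S] and is smaller, whence the induction. *)
Lemma splitting_contr D S : building D -> splitting D -> splitting (contr D S).
Proof.
move=> bD sD _ /contrP[A [AD AS ->]].
have [k] := ubnP #|A|; elim: k A AD AS => // k IH A AD AS; rewrite ltnS => Ak A1.
have A2' : (1 < #|A|)%N.
  by apply: leq_trans A1 _; rewrite subset_leq_card ?subsetDl.
have [A1' [A2 [A1D A2D dA AE]]] := sD A AD A2'.
have /andP[c1 c2] := split_card_lt bD A1D A2D dA AE.
have [A1S|A1S] := boolP (A1' \subset S).
  have e : A :\: S = A2 :\: S.
    by rewrite AE setDUl; move: A1S; rewrite -setD_eq0 => /eqP->; rewrite set0U.
  rewrite e in A1 *; apply: IH => //; last exact: leq_trans c2 Ak.
  by apply: contraNN AS => A2S; rewrite AE subUset A1S.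
have [A2S|A2S] := boolP (A2 \subset S).
  have e : A :\: S = A1' :\: S.
    by rewrite AE setDUl; move: A2S; rewrite -setD_eq0 => /eqP->; rewrite setU0.
  rewrite e in A1 *; apply: IH => //; exact: leq_trans c1 Ak.
exists (A1' :\: S), (A2 :\: S); split.
- by apply/contrP; exists A1'.
- by apply/contrP; exists A2.
- by apply: disjointW dA; apply: subsetDl.
- by rewrite AE setDUl.
Qed.

Lemma splitting_singleton D A i : building D -> splitting D -> A \in D -> i \in A ->
  [set i]%SET \in D.
Proof.
move=> bD sD; have [k] := ubnP #|A|; elim: k A => // k IH A; rewrite ltnS => Ak AD iA.
have [A1|A1] := leqP #|A| 1.
  by have /eqP -> : [set i]%SET == A; rewrite // eqEcard sub1set iA cards1.
have [A1' [A2 [A1D A2D dA AE]]] := sD A AD A1.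
have /andP[c1 c2] := split_card_lt bD A1D A2D dA AE.
move: iA; rewrite AE inE => /orP[iA|iA].
  by apply: (IH A1') => //; apply: leq_trans c1 Ak.
by apply: (IH A2) => //; apply: leq_trans c2 Ak.
Qed.

(** A minimal member of [D2] missing from [D1] is a disjoint union of two members
    of [D1].  Among all such unions that are missing from [D1], a maximal one
    can be added: if a member [T] meets [S1] but not [S2], then the union of [T]
    and [S] is again of this kind, so it lies in [D1] or equals [S] by
    maximality. *)
Lemma exists_set_to_add D1 D2 :
  building D1 -> building D2 -> D1 \subset D2 -> D1 != D2 ->
  splitting D2 -> {in D2, forall A, (#|A| <= 1)%N -> A \in D1} ->
  exists S S1 S2, [/\ S \in D2 :\: D1, S1 \in D1, S2 \in D1, [disjoint S1 & S2] &
    S = S1 :|: S2 /\ building (S |: D1)].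
Proof.
move=> b1 b2 D12 nD s2 sing.
pose Q (S : {set 'I_m}) := (S \in D2 :\: D1) &&
  [exists S1 in D1, exists S2 in D1, [disjoint S1 & S2] && (S == S1 :|: S2)].
have [S0 Q0] : exists S, Q S.
  have /set0Pn[A0 A0D] : D2 :\: D1 != set0.
    by rewrite setD_eq0; apply: contraNN nD => D21; rewrite eqEsubset D12.
  case: (arg_minnP (fun A : {set 'I_m} => #|A|) A0D) => A AD Amin.
  have {}AD : A \in D2 :\: D1 := AD.
  exists A; rewrite /Q AD /=; move: AD; rewrite inE => /andP[nAD AD].
  have A1 : (1 < #|A|)%N by rewrite ltnNge; apply: contraNN nAD; apply: sing.
  have [A1' [A2 [A1D A2D dA AE]]] := s2 A AD A1.
  have /andP[c1 c2] := split_card_lt b2 A1D A2D dA AE.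
  have inD1 T : T \in D2 -> (#|T| < #|A|)%N -> T \in D1.
    move=> TD; rewrite ltnNge; apply: contraNT => nT; apply: (Amin T).
    by have : T \in D2 :\: D1 by rewrite inE nT.
  apply/exists_inP; exists A1'; first exact: inD1.
  by apply/exists_inP; exists A2; rewrite ?dA ?AE //=; apply: inD1.
case: (arg_maxnP (fun A : {set 'I_m} => #|A|) Q0) => S /andP[SD] /exists_inP[S1 S1D].
case/exists_inP=> S2 S2D /andP[dS /eqP SE] Smax.
exists S, S1, S2; split=> //; split=> //.
have SD2 : S \in D2 by move: SD; rewrite inE => /andP[].
have S12 (T T1 T2 : {set 'I_m}) : T \in D1 -> T1 \in D1 -> T2 \in D1 ->
    [disjoint T1 & T2] -> S = T1 :|: T2 -> ~~ [disjoint T & T1] -> T :|: S \in S |: D1.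
  move=> TD T1D T2D dT ST TT1; have TT1D := b1.2 _ _ TD T1D TT1.
  have E : T :|: S = (T :|: T1) :|: T2 by rewrite ST setUA.
  have [dT2|TT2] := boolP [disjoint T :|: T1 & T2]; last first.
    by rewrite inE E b1.2 // orbT.
  rewrite !inE; case TSD: (T :|: S \in D1); rewrite ?orbT // orbF.
  rewrite eq_sym eqEcard subsetUr; apply: Smax; rewrite /Q inE TSD /=.
  apply/andP; split.
    apply: b2.2 => //; first exact: (subsetP D12).
    by apply: contraNN TT1; apply: disjointWr; rewrite ST subsetUl.
  apply/exists_inP; exists (T :|: T1) => //.
  by apply/exists_inP; exists T2; rewrite // dT2 E eqxx.
have TSU T : T \in D1 -> ~~ [disjoint T & S] -> T :|: S \in S |: D1.
  move=> TD TS; have [dT1|TT1] := boolP [disjoint T & S1]; last first.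
    exact: (S12 T S1 S2).
  have [dT2|TT2] := boolP [disjoint T & S2]; last first.
    by apply: (S12 T S2 S1); rewrite // 1?disjoint_sym // SE setUC.
  by case/negP: TS; rewrite SE -setI_eq0 setIUr setU_eq0 !setI_eq0 dT1.
split; first by rewrite !inE negb_or b1.1 eq_sym andbT (mem_building_neq0 b2 SD2).
move=> T1 T2; rewrite !inE => /orP[/eqP->|T1D] /orP[/eqP->|T2D] TT.
- by rewrite setUid eqxx.
- by rewrite -in_setU1 setUC TSU // disjoint_sym.
- by rewrite -in_setU1 TSU.
- by rewrite b1.2 // orbT.
Qed.

Lemma top_contr D C S : top D C -> ~~ (C \subset S) -> top (contr D S) (C :\: S).
Proof.
move=> [CD Ctop] CS; split; first by apply/contrP; exists C.
by move=> _ /contrP[A [AD _ ->]]; apply/setSD/Ctop.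
Qed.

Lemma top_restr D S : S \in D -> top (restr D S) S.
Proof.
by move=> SD; split=> [|A]; rewrite inE ?SD ?subxx // => /andP[].
Qed.

(** Monotonicity, assuming nonnegativity on smaller ground sets: each set added
    on the way from [D1] to [D2] contributes [t] times a product of three
    h-polynomials of dimensions [#|S1| - 1], [#|S2| - 1] and [#|C :\: S| - 1]. *)
Lemma gammapos_sub D1 D2 C :
  (forall D S, (#|S| < #|C|)%N -> building D -> splitting D -> top D S ->
     gammapos #|S|.-1 (h D)) ->
  building D1 -> building D2 -> splitting D1 -> splitting D2 -> D1 \subset D2 ->
  top D1 C -> top D2 C ->
  gammapos #|C|.-1 (h D2 - h D1).
Proof.
move=> IHC + b2 + s2; have [k] := ubnP #|D2 :\: D1|.
elim: k D1 => // k IH D1; rewrite ltnS => Dk b1 s1 D12 t1 t2.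
have [->|nD] := eqVneq D1 D2; first by rewrite subrr; apply: gammapos0.
have sing : {in D2, forall A, (#|A| <= 1)%N -> A \in D1}.
  move=> A AD A1; have A0 := mem_building_neq0 b2 AD.
  have /cards1P[i Ai] : #|A| == 1%N by rewrite eqn_leq A1 card_gt0.
  rewrite Ai; apply: splitting_singleton b1 s1 t1.1 _.
  by rewrite -sub1set -Ai; apply: t2.2.
have [S [S1 [S2 [SD S1D S2D dS [SE bS]]]]] := exists_set_to_add b1 b2 D12 nD s2 sing.
move: (SD); rewrite inE => /andP[SD1 SD2].
have sS : splitting (S |: D1).
  move=> A; rewrite inE => /orP[|AD A1].
    by rewrite inE => /eqP-> _; exists S1, S2; rewrite !inE S1D S2D !orbT.
  have [A1' [A2 [A1D A2D dA AE]]] := s1 A AD A1.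
  by exists A1', A2; rewrite !inE A1D A2D !orbT.
have SC : S \subset C by apply: t2.2.
have nCS : ~~ (C \subset S).
  by apply: contraNN SD1 => CS; have /eqP -> : S == C; rewrite ?eqEsubset ?SC // t1.1.
have -> : h D2 - h D1 = (h D2 - h (S |: D1)) + (h (S |: D1) - h D1) by ring.
apply: gammaposD.
  apply: IH => //.
  - apply: leq_trans Dk; apply: proper_card; apply/properP; split.
      by apply/subsetP => A; rewrite !inE negb_or -andbA => /and3P[_ -> ->].
    by exists S; rewrite // !inE eqxx.
  - by apply/subsetP => A; rewrite !inE => /orP[/eqP-> //|]; apply: (subsetP D12).
  - split=> [|A]; first by rewrite inE t1.1 orbT.
    by rewrite !inE => /orP[/eqP-> //|]; apply: t1.2.
rewrite (hpol_add_set R b1 bS SD1 S1D S2D dS SE) addrC addKr.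
have /andP[c1 c2] := split_card_lt b1 S1D S2D dS SE.
have CSc : #|C| = (#|S| + #|C :\: S|)%N by rewrite -(cardsID S C) (setIidPr SC).
have C0 : (0 < #|C :\: S|)%N by rewrite card_gt0 setD_eq0.
have Sc : #|S| = (#|S1| + #|S2|)%N by rewrite SE cards_disjointU.
have S1_gt0 : (0 < #|S1|)%N by rewrite card_gt0 (mem_building_neq0 b1 S1D).
have S2_gt0 : (0 < #|S2|)%N by rewrite card_gt0 (mem_building_neq0 b1 S2D).
have lt_SC T : (#|T| < #|S|)%N -> (#|T| < #|C|)%N.
  by move=> lt_TS; apply: leq_trans lt_TS (subset_leq_card SC).
rewrite CSc Sc pred_add3 //; apply: gammaposM; first exact: gammaposX.
apply: gammaposM; first apply: gammaposM.
- apply: IHC; first exact: lt_SC.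
  + exact: building_restr.
  + exact: splitting_restr.
  + exact: top_restr.
- apply: IHC; first exact: lt_SC.
  + exact: building_restr.
  + exact: splitting_restr.
  + exact: top_restr.
- apply: IHC; first by rewrite CSc -[ltnLHS]add0n ltn_add2r (leq_trans _ c1).
  + exact: building_contr.
  + exact: splitting_contr.
  + exact: top_contr.
Qed.

(** With [C] the disjoint union of [S1] and [S2], the members contained in [S1]
    or in [S2], together with [C], form the building set of the product of two
    smaller nestohedra and a segment.  The remaining members are then added by
    [gammapos_sub]. *)
Lemma gammapos_hpol D C : building D -> splitting D -> top D C ->
  gammapos #|C|.-1 (h D).
Proof.
have [k] := ubnP #|C|; elim: k C D => // k IH C D; rewrite ltnS => Ck bD sD tC.
have C0 := mem_building_neq0 bD tC.1.
have [C1|C1] := leqP #|C| 1.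
  have -> : D = [set C]%SET.
    apply/eqP; rewrite eqEsubset sub1set tC.1 andbT; apply/subsetP => A AD.
    rewrite inE eqEcard tC.2 // (leq_trans C1) // card_gt0.
    exact: mem_building_neq0 AD.
  rewrite hpol_single //  (eqP (_ : #|C|.-1 == 0%N)).
    exact: gammapos1.
  by move: C1; case: #|C| => [|[]].
have [S1 [S2 [S1D S2D dS SE]]] := sD C tC.1 C1.
have /andP[c1 c2] := split_card_lt bD S1D S2D dS SE.
have [S1C S2C] : S1 \subset C /\ S2 \subset C by rewrite SE subsetUl subsetUr.
have S10 := mem_building_neq0 bD S1D.
have S20 := mem_building_neq0 bD S2D.
pose D0 := restr D S1 :|: restr D S2.
have CD0 : C \notin D0.
  rewrite !inE !negb_or tC.1 /=; apply/andP; split.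
    by apply/negP => /subset_leq_card; rewrite leqNgt c1.
  by apply/negP => /subset_leq_card; rewrite leqNgt c2.
have S1D0 : S1 \in D0 by rewrite !inE S1D subxx.
have S2D0 : S2 \in D0 by rewrite !inE S2D subxx orbT.
have D0sub T : T \in D0 -> T \in D by rewrite !inE => /orP[] /andP[].
have b0 : building D0.
  split; first by rewrite !inE (negPf bD.1).
  move=> A1 A2; rewrite !inE => /orP[] /andP[A1D A1S] /orP[] /andP[A2D A2S] dA.
  - by rewrite bD.2 // subUset A1S A2S.
  - by case/negP: dA; apply: disjointW dS.
  - by case/negP: dA; rewrite disjoint_sym; apply: disjointW dS.
  - by rewrite bD.2 //= !subUset A1S A2S orbT.
have b1 : building (C |: D0).
  split; first by rewrite in_setU1 eq_sym (negPf C0) (negPf b0.1).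
  move=> A1 A2; rewrite !in_setU1 => /orP[/eqP->|A1D] /orP[/eqP->|A2D] dA.
  - by rewrite setUid eqxx.
  - by apply/orP; left; apply/eqP/setUidPl/tC.2/D0sub.
  - by apply/orP; left; apply/eqP/setUidPr/tC.2/D0sub.
  - by rewrite b0.2 ?orbT.
have r1 : restr D0 S1 = restr D S1.
  apply/setP => A; rewrite !inE; apply/idP/idP => [/andP[/orP[] /andP[-> _] ->] //|].
  by move=> /andP[-> ->].
have r2 : restr D0 S2 = restr D S2.
  apply/setP => A; rewrite !inE; apply/idP/idP => [/andP[/orP[] /andP[-> _] ->] //|].
  by move=> /andP[-> ->]; rewrite orbT.
have c0 : contr D0 C = set0.
  apply/eqP; rewrite -subset0; apply/subsetP => _ /contrP[A [AD /negP[]]].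
  exact/tC.2/D0sub.
have -> : h D = h (C |: D0) + (h D - h (C |: D0)) by ring.
have cC : #|C| = (#|S1| + #|S2|)%N by rewrite SE cards_disjointU.
have c10 : (0 < #|S1|)%N by rewrite card_gt0.
have c20 : (0 < #|S2|)%N by rewrite card_gt0.
apply: gammaposD.
  rewrite (hpol_add_set R b0 b1 CD0 S1D0 S2D0 dS SE) r1 r2 c0 hpol_set0 mulr1.
  rewrite hpol_mul; last 2 first.
  - exact: building_restr.
  - move=> A1 A2; rewrite !inE => /andP[_ A1S] /andP[_ A2S].
    exact: disjointW dS.
  have -> : forall p : {poly int}, p + 'X * p = (1 + 'X) * p by move=> p; ring.
  rewrite cC pred_add2 //.
  apply: gammaposM; first exact: gammapos1X.
  apply: gammaposM; apply: IH.
  - exact: leq_trans c1 Ck.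
  - exact: building_restr.
  - exact: splitting_restr.
  - exact: top_restr.
  - exact: leq_trans c2 Ck.
  - exact: building_restr.
  - exact: splitting_restr.
  - exact: top_restr.
apply: gammapos_sub => //.
- by move=> D' S SC; apply: IH; apply: leq_trans SC Ck.
- move=> A; rewrite in_setU1 => /orP[/eqP-> _|].
    by exists S1, S2; rewrite !in_setU1 S1D0 S2D0 !orbT.
  rewrite inE => /orP[] AD A1.
    have [A1' [A2 [A1D A2D dA AE]]] := splitting_restr sD AD A1.
    by exists A1', A2; rewrite !in_setU1 !in_setU A1D A2D !orbT.
  have [A1' [A2 [A1D A2D dA AE]]] := splitting_restr sD AD A1.
  by exists A1', A2; rewrite !in_setU1 !in_setU A1D A2D !orbT.
- by apply/subsetP => A; rewrite in_setU1 => /orP[/eqP->|/D0sub //]; apply: tC.1.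
- split; first exact: setU11.
  by move=> A; rewrite in_setU1 => /orP[/eqP-> //|/D0sub]; apply: tC.2.
Qed.

End Flag.

(** * Faces of the nestohedron *)

Lemma exists_free_span (K : fieldType) (vT : vectType K) (X : seq vT) :
  exists Y : seq vT, [/\ {subset Y <= X}, free Y & <<Y>>%VS = <<X>>%VS].
Proof.
elim: X => [|x X [Y [YX fY sY]]]; first by exists [::]; rewrite nil_free.
have [xX|xX] := boolP (x \in <<X>>%VS).
  exists Y; split=> //; first by move=> y /YX; rewrite inE orbC => ->.
  by rewrite sY span_cons; apply/esym/addv_idPr; rewrite -memvE.
exists (x :: Y); split; last by rewrite !span_cons sY.
  by move=> y; rewrite !inE => /orP[->//|/YX ->]; rewrite orbT.
by rewrite free_cons sY xX.
Qed.

Section Geometry.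
Variables (R : realType) (m : nat).
Implicit Types (A C M S T : {set 'I_m}) (B : {set {set 'I_m}}) (c : 'I_m -> R).
Implicit Types (phi psi : {ffun {set 'I_m} -> {set 'I_m}}) (x : 'rV[R]_m).

Definition linform c x := \sum_i x 0 i * c i.

Lemma linform_sum c (I : finType) (J : {set I}) (y : I -> 'rV[R]_m) :
  linform c (\sum_(i in J) y i) = \sum_(i in J) linform c (y i).
Proof.
rewrite /linform exchange_big /=; apply: eq_bigr => i _.
by rewrite summxE mulr_suml.
Qed.

Lemma linform_delta c i : linform c (delta_mx 0 i) = c i.
Proof.
rewrite /linform (bigD1 i) //= mxE !eqxx mul1r big1 ?addr0 // => j ji.
by rewrite mxE (negPf ji) andbF mul0r.
Qed.

Lemma delta_out A i j : i \in A -> j \notin A -> (delta_mx 0 i : 'rV[R]_m) 0 j = 0.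
Proof.
move=> iA jA; rewrite mxE (_ : (j == i) = false) ?andbF //.
by apply: contraNF jA => /eqP->.
Qed.

Lemma simplexP S x : simplex S x ->
  [/\ forall i, 0 <= x 0 i, forall i, i \notin S -> x 0 i = 0 & \sum_i x 0 i = 1].
Proof.
move=> Sx; apply: (Sx [set x : 'rV[R]_m | [/\ forall i, 0 <= x 0 i,
  forall i, i \notin S -> x 0 i = 0 & \sum_i x 0 i = 1]]%classic); split.
  apply/convex_setW => y z /set_mem[y0 yS y1] /set_mem[z0 zS z1] k k0 k1.
  apply/mem_set.
  have yzE i : (conv k y z : 'rV[R]_m) 0 i = k%:num * y 0 i + (1 - k%:num) * z 0 i.
    by rewrite !mxE.
  split.
  - by move=> i; rewrite yzE addr_ge0 // mulr_ge0 // ?ltW // subr_gt0.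
  - by move=> i iS; rewrite yzE yS // zS // !mulr0 addr0.
  under eq_bigr do rewrite yzE.
  by rewrite big_split /= -!mulr_sumr y1 z1 !mulr1 addrC subrK.
move=> _ [i iS <-]; split; last exact: sum_delta.
- by move=> j; rewrite mxE; case: (_ && _).
- by move=> j; apply: delta_out.
Qed.

Lemma simplex_vertex S i : i \in S -> simplex S (delta_mx 0 i : 'rV[R]_m).
Proof. by move=> iS A [_]; apply; exists i. Qed.

(** Some vertex of the simplex on [A]; the value for empty [A] is arbitrary. *)
Definition vert A : 'rV[R]_m := if [pick i in A] is Some i then delta_mx 0 i else 0.

Lemma vertP A : A != set0 -> exists2 i, i \in A & vert A = delta_mx 0 i.
Proof.
rewrite /vert => /set0Pn[j jA]; case: pickP => [i iA|/(_ j)]; first by exists i.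
by rewrite jA.
Qed.

Definition vmax c S := linform c (vert (argmax c S)).

(** The deficit from the maximum is the sum of the [x_i (max - c_i)], whose terms
    are nonnegative and vanish only if [x_i = 0] or [i] is a maximiser. *)
Lemma simplex_le c S x : S != set0 -> simplex S x ->
  linform c x <= vmax c S ?= iff [forall (i | i \notin argmax c S), x 0 i == 0].
Proof.
move=> S0 /simplexP[x0 xS x1].
have [a /argmaxP[aS aM] vE] := vertP (argmax_neq0 c S0).
have -> : vmax c S = c a by rewrite /vmax vE linform_delta.
have E : c a - linform c x = \sum_i x 0 i * (c a - c i).
  under eq_bigr do rewrite mulrBr.
  by rewrite sumrB -mulr_suml x1 mul1r.
have ge i : 0 <= x 0 i * (c a - c i).
  have [iS|iS] := boolP (i \in S); last by rewrite xS // mul0r.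
  by rewrite mulr_ge0 // subr_ge0 aM.
split; first by rewrite -subr_ge0 E sumr_ge0.
rewrite eq_sym -subr_eq0 E psumr_eq0 //; apply/allP/forall_inP => [H i|H i _].
  have := H i (mem_index_enum i) => /=; rewrite mulf_eq0 => /orP[-> //|].
  rewrite subr_eq0 => /eqP ci; have [iS|iS] := boolP (i \in S); last by rewrite xS.
  by case/negP; apply/argmaxP; split=> // j jS; rewrite -ci aM.
rewrite implyTb; have [/argmaxP[iS iM]|iM] := boolP (i \in argmax c S); last first.
  by rewrite (eqP (H i iM)) mul0r eqxx.
by rewrite mulf_eq0 subr_eq0 (@le_anti _ _ (c a) (c i)) ?eqxx ?orbT // aM ?iM.
Qed.

(** Describing the summands by their supports makes the face depend on [phi]
    alone, so that functionals with the same maximisers give the same face. *)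
Definition faceof B phi : set 'rV[R]_m :=
  [set x | exists2 y : {set 'I_m} -> 'rV[R]_m,
     forall S, S \in B -> simplex S (y S) /\ (forall i, i \notin phi S -> y S 0 i = 0)
   & x = \sum_(S in B) y S]%classic.

Lemma nestohedron_le B c x : set0 \notin B -> nestohedron R B x ->
  linform c x <= \sum_(S in B) vmax c S.
Proof.
move=> B0 [y yS ->]; rewrite linform_sum; apply: ler_sum => S SB.
have S0 : S != set0 by apply: contraNneq B0 => <-.
by have [] := simplex_le c S0 (yS S SB).
Qed.

(** A sum of inequalities is an equality only if each of them is, whatever
    decomposition of the point into summands is chosen. *)
Lemma vmax_attained B c (y : {set 'I_m} -> 'rV[R]_m) : set0 \notin B ->
  (forall S, S \in B -> simplex S (y S)) ->
  linform c (\sum_(S in B) y S) = \sum_(S in B) vmax c S ->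
  forall S, S \in B -> forall i, i \notin argmax_map c B S -> y S 0 i = 0.
Proof.
move=> B0 yS; rewrite linform_sum => E S SB.
have S0 T : T \in B -> T != set0 by move=> TB; apply: contraNneq B0 => <-.
have le T : T \in B -> linform c (y T) <= vmax c T.
  by move=> TB; have [] := simplex_le c (S0 T TB) (yS T TB).
have /eqP : \sum_(S in B) (vmax c S - linform c (y S)) = 0 by rewrite sumrB E subrr.
rewrite psumr_eq0 => [/allP/(_ S (mem_index_enum S))|T TB]; last first.
  by rewrite subr_ge0 le.
rewrite SB /= subr_eq0 eq_sym; have [_ ->] := simplex_le c (S0 S SB) (yS S SB).
by move=> /forall_inP H i; rewrite argmax_map_in // => /H/eqP.
Qed.

Lemma faceof_argmax_map B c : set0 \notin B -> faceof B (argmax_map c B) =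
  [set x | nestohedron R B x /\ linform c x = \sum_(S in B) vmax c S]%classic.
Proof.
move=> B0; apply/seteqP; split=> x.
  move=> [y yS ->]; split; first by exists y => // S /yS[].
  rewrite linform_sum; apply: eq_bigr => S SB; have [ySS yS0] := yS S SB.
  have S0 : S != set0 by apply: contraNneq B0 => <-.
  apply/eqP; have [_ ->] := simplex_le c S0 ySS.
  by apply/forall_inP => i; rewrite -(argmax_map_in c SB) => /yS0/eqP.
move=> [[y yS ->] E]; exists y => // S SB; split; first exact: yS.
exact: vmax_attained E S SB.
Qed.

Lemma vert_face B phi S :
  phi \in argmax_maps R B -> set0 \notin B -> S \in B ->
  simplex S (vert (phi S)) /\ (forall i, i \notin phi S -> vert (phi S) 0 i = 0).
Proof.
move=> /argmax_mapsP[c ->] B0 SB; rewrite argmax_map_in //.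
have S0 : S != set0 by apply: contraNneq B0 => <-.
have [i iM ->] := vertP (argmax_neq0 c S0); split.
  by apply: simplex_vertex; apply: (subsetP (argmax_sub c S)).
by move=> j; apply: delta_out.
Qed.

(** Starting from a fixed vertex of the face, moving a single summand to another
    vertex [e_i]: these points separate the faces and span their directions. *)
Definition swap_vert phi S i T : 'rV[R]_m :=
  if T == S then delta_mx 0 i else vert (phi T).

Lemma swap_vertP B phi S i T :
  phi \in argmax_maps R B -> set0 \notin B -> S \in B -> i \in phi S -> T \in B ->
  simplex T (swap_vert phi S i T) /\
  (forall j, j \notin phi T -> swap_vert phi S i T 0 j = 0).
Proof.
move=> cp B0 SB iS TB; rewrite /swap_vert.
case: (T =P S) => [->|_]; last exact: (vert_face cp B0 TB).
split; last by move=> j; apply: delta_out.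
apply: simplex_vertex; move: iS; case/argmax_mapsP: cp => c ->.
by rewrite argmax_map_in //; apply: (subsetP (argmax_sub _ _)).
Qed.

Lemma sum_swap_vert B phi S i : S \in B ->
  \sum_(T in B) swap_vert phi S i T =
  \sum_(T in B) vert (phi T) + (delta_mx 0 i - vert (phi S)).
Proof.
move=> SB; rewrite (bigD1 S) //= /swap_vert eqxx [in RHS](bigD1 S) //=.
rewrite (eq_bigr (fun T => vert (phi T))); last by move=> T /andP[_ /negPf->].
by rewrite [RHS]addrAC [X in _ = X + _]addrC subrK.
Qed.

Lemma vert_move B phi S i :
  phi \in argmax_maps R B -> set0 \notin B -> S \in B -> i \in phi S ->
  faceof B phi (\sum_(T in B) vert (phi T) + (delta_mx 0 i - vert (phi S))).
Proof.
move=> cp B0 SB iS; exists (swap_vert phi S i); last by rewrite sum_swap_vert.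
by move=> T TB; apply: (swap_vertP cp B0 SB iS TB).
Qed.

Lemma faceof_vert B phi : phi \in argmax_maps R B -> set0 \notin B ->
  faceof B phi (\sum_(T in B) vert (phi T)).
Proof.
move=> cp B0; exists (fun T => vert (phi T)) => // S SB.
exact: (vert_face cp B0 SB).
Qed.

(** The support of one summand can be any vertex allowed by [phi], and
    [vmax_attained] shows that it is then allowed by [psi]. *)
Lemma faceof_inj B : set0 \notin B -> {in argmax_maps R B &, injective (faceof B)}.
Proof.
move=> B0.
suff sub phi psi : phi \in argmax_maps R B -> psi \in argmax_maps R B ->
    faceof B phi = faceof B psi -> forall S, phi S \subset psi S.
  move=> phi psi cp cq E; apply/ffunP => S; apply/eqP.
  by rewrite eqEsubset !sub.
move=> cp /argmax_mapsP[c ->] E S; have [SB|SB] := boolP (S \in B); last first.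
  by case/argmax_mapsP: cp => d ->; rewrite argmax_map_out // sub0set.
apply/subsetP => i iS.
have := vert_move cp B0 SB iS; rewrite E faceof_argmax_map // => -[_ lE].
apply: contraT => iM; rewrite -sum_swap_vert // in lE.
have yT T : T \in B -> simplex T (swap_vert phi S i T).
  by move=> TB; have [] := swap_vertP cp B0 SB iS TB.
have /eqP := vmax_attained B0 yT lE SB iM.
by rewrite /swap_vert eqxx mxE !eqxx oner_eq0.
Qed.

Lemma mulmx_linform x (c : 'cV[R]_m) : (x *m c) 0 0 = linform (fun i => c i 0) x.
Proof. by rewrite mxE. Qed.

Lemma is_face_nestohedron B F : set0 \notin B ->
  is_face (nestohedron R B) F <->
  exists2 phi, phi \in argmax_maps R B & F = faceof B phi.
Proof.
move=> B0; split.
  move=> [[x Fx] [c [b [cb FE]]]]; exists (argmax_map (fun i => c i 0) B).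
    exact: mem_argmax_maps.
  have bE : b = \sum_(S in B) vmax (fun i => c i 0) S.
    apply/le_anti/andP; split.
      by move: Fx; rewrite FE => -[Px <-]; rewrite mulmx_linform nestohedron_le.
    have := faceof_vert (mem_argmax_maps (fun i => c i 0) B) B0.
    rewrite faceof_argmax_map // => -[Px <-]; rewrite -mulmx_linform; exact: cb.
  rewrite FE faceof_argmax_map // bE.
  by apply/seteqP; split=> z /=; rewrite mulmx_linform.
move=> [phi cp ->]; split; first by eexists; apply: faceof_vert.
case/argmax_mapsP: cp => c ->; exists (\col_i c i), (\sum_(S in B) vmax c S).
have lE z : (z *m (\col_i c i)) 0 0 = linform c z.
  by rewrite mulmx_linform /linform; apply: eq_bigr => i _; rewrite mxE.
split; first by move=> z Pz; rewrite lE nestohedron_le.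
by rewrite faceof_argmax_map //; apply/seteqP; split=> z /=; rewrite lE.
Qed.

(** Differences of points of the face lie in the sum of the direction spaces,
    and this sum is spanned by the moves of [vert_move], among which a basis can
    be chosen. *)
Lemma affdim_faceof B phi : phi \in argmax_maps R B -> set0 \notin B ->
  affdim (faceof B phi) = cdim R phi.
Proof.
move=> cp B0; set U := (\sum_S dirs R (phi S))%VS.
have diff x x' : faceof B phi x -> faceof B phi x' -> x - x' \in U.
  move=> [y yS ->] [z zS ->]; rewrite -sumrB; apply: memv_suml => S SB.
  have [/simplexP[_ _ y1] y0] := yS S SB; have [/simplexP[_ _ z1] z0] := zS S SB.
  apply: (subvP (sumv_sup S _ (subvv _))) => //; apply/dirsP; split.
    by move=> i iS; rewrite !mxE y0 // z0 // subrr.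
  under eq_bigr do rewrite mxE [X in _ + X]mxE.
  by rewrite sumrB y1 z1 subrr.
apply/eqP; rewrite eqn_leq; apply/andP; split.
  apply/bigmax_leqP => k /asboolP[x0 [v [Fx0 Fv fv]]].
  have /eqP <- : size v == k by rewrite size_tuple.
  move: fv; rewrite /free => /eqP <-; apply: dimvS; apply/span_subvP => w /tnthP[i ->].
  by have := diff _ _ (Fv i) Fx0; rewrite addrAC subrr add0r.
pose X := [seq delta_mx 0 p.2 - vert (phi p.1) |
   p <- enum (finset (fun p : {set 'I_m} * 'I_m => (p.1 \in B) && (p.2 \in phi p.1)))].
have XU : (U <= <<X>>)%VS.
  apply/subv_sumP => S _; have [SB|SB] := boolP (S \in B); last first.
    by case/argmax_mapsP: cp => c ->; rewrite argmax_map_out // dirs0 sub0v.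
  have iX i : i \in phi S -> delta_mx 0 i - vert (phi S) \in <<X>>%VS.
    move=> iS; apply: memv_span; apply/mapP; exists (S, i) => //.
    by rewrite mem_enum inE SB.
  apply/span_subvP => _ /allpairsP[[i j] /= [+ + ->]]; rewrite !mem_enum => iS jS.
  have -> : delta_mx 0 i - delta_mx 0 j =
    (delta_mx 0 i - vert (phi S)) - (delta_mx 0 j - vert (phi S)) :> 'rV[R]_m.
    by rewrite opprB addrA subrK.
  by rewrite memvB ?iX.
have [Y [YX fY sY]] := exists_free_span X.
have Ule : (\dim U <= size Y)%N.
  by move: fY; rewrite /free => /eqP <-; rewrite sY dimvS.
have sYm : (size Y < m.+1)%N.
  move: fY; rewrite /free => /eqP <-; rewrite ltnS.
  apply: leq_trans (dimvS (subvf _)) _.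
  by rewrite dimvf dim_matrix [X in (X <= _)%N]mul1n.
apply: leq_trans Ule _; rewrite /affdim.
apply: (leq_bigmax_cond (Ordinal sYm)); apply/asboolP.
exists (\sum_(T in B) vert (phi T)), (in_tuple Y); split=> //.
  exact: faceof_vert.
move=> i; have /YX/mapP[[S j] /=] := mem_tnth i (in_tuple Y).
by rewrite mem_enum inE /= => /andP[SB jS] ->; apply: vert_move.
Qed.

Lemma nestohedronE B : set0 \notin B ->
  nestohedron R B = faceof B (argmax_map (fun=> 0%R : R) B).
Proof.
move=> B0; rewrite faceof_argmax_map //.
have l0 x : linform (fun=> 0) x = 0 by rewrite /linform big1 // => i _; rewrite mulr0.
apply/seteqP; split=> [x Px|x [] //]; split=> //.
by rewrite l0 big1 // => S _; rewrite /vmax l0.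
Qed.

Lemma argmax_map0 B S : S \in B -> argmax_map (fun=> 0%R : R) B S = S.
Proof.
move=> SB; rewrite argmax_map_in //; apply/setP => i; apply/argmaxP/idP => [[]//|iS].
by split.
Qed.

Lemma cdim_max B phi : phi \in argmax_maps R B ->
  (cdim R phi <= cdim R (argmax_map (fun=> 0%R : R) B))%N.
Proof.
case/argmax_mapsP => c ->; apply: dimvS; apply/subv_sumP => S _.
apply: (sumv_sup S) => //; have [SB|SB] := boolP (S \in B).
  by apply: dirsS; rewrite argmax_map0 // argmax_map_in // argmax_sub.
by rewrite argmax_map_out // dirs0 sub0v.
Qed.

Lemma face_number_nestohedron B i : set0 \notin B -> face_number (nestohedron R B) i =
  #|[set phi in argmax_maps R B | cdim R phi == i]|.
Proof.
move=> B0; rewrite /face_number.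
set Q := [set phi in argmax_maps R B | cdim R phi == i]%SET.
have -> : [set F | is_face (nestohedron R B) F /\ affdim F = i]%classic =
   [set` [fset faceof B phi | phi in Q]%fset]%classic.
  apply/seteqP; split=> F /=.
    move=> [/(is_face_nestohedron _ B0)[phi cp ->] aF].
    apply/imfsetP; exists phi => //=.
    by rewrite inE cp -(affdim_faceof cp B0) aF eqxx.
  move=> /imfsetP[phi /=]; rewrite inE => /andP[cp /eqP d] ->; split.
    by apply/(is_face_nestohedron _ B0); exists phi.
  by rewrite affdim_faceof.
rewrite set_fsetK card_in_imfset /=.
  by rewrite cardE.
by move=> phi psi /setIdP[cp _] /setIdP[cq _]; exact: (faceof_inj B0 cp cq).
Qed.

Lemma h_poly_nestohedron B : set0 \notin B -> h_poly (nestohedron R B) = hpol R B.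
Proof.
move=> B0; have aN : affdim (nestohedron R B) = cdim R (argmax_map (fun=> 0%R : R) B).
  by rewrite nestohedronE // affdim_faceof ?mem_argmax_maps.
rewrite /h_poly aN; set N := cdim _ _.
rewrite /hpol (partition_big (fun phi => inord (cdim R phi) : 'I_N.+1) xpredT) //=.
apply: eq_bigr => i _; rewrite face_number_nestohedron //.
have pE phi : phi \in argmax_maps R B ->
    (inord (cdim R phi) == i :> 'I_N.+1) = (cdim R phi == i).
  by move=> cp; rewrite -val_eqE /= inordK // ltnS cdim_max.
rewrite (eq_bigr (fun=> ('X - 1) ^+ i)); last first.
  by move=> phi /andP[cp]; rewrite pE // => /eqP->.
rewrite sumr_const mulr_natl; congr (_ *+ _).
by apply: eq_card => phi; rewrite in_set; apply: andb_id2l => cp; rewrite pE.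
Qed.

Lemma affdim_nestohedron B : set0 \notin B -> [set: 'I_m]%SET \in B ->
  affdim (nestohedron R B) = m.-1.
Proof.
move=> B0 TB; rewrite nestohedronE // affdim_faceof ?mem_argmax_maps // /cdim.
rewrite -[in RHS](card_ord m) -cardsT -(dim_dirs R); congr (\dim _); apply/eqP.
rewrite eqEsubv; apply/andP; split.
  by apply/subv_sumP => S _; apply/dirsS/subsetT.
by apply: (sumv_sup [set: 'I_m]%SET); rewrite // argmax_map0.
Qed.

End Geometry.

(** * Flag nestohedra come from splitting building sets *)

Section FlagNestohedron.
Variables (R : realType) (m : nat) (B : {set {set 'I_m}}).
Hypotheses (bB : building B) (BT : [set: 'I_m]%SET \in B).
Implicit Types (A S T : {set 'I_m}).

Let B0 : set0 \notin B := bB.1.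

Definition outside A : 'I_m -> R := fun i => (i \notin A)%:R.

(** Maximising the coordinates outside [A] amounts to minimising those in [A],
    as the coordinate sum is constant on the nestohedron. *)
Definition facet A := faceof B (argmax_map (outside A) B) : set 'rV[R]_m.

Lemma argmax_map_outside A T : T \in B ->
  argmax_map (outside A) B T = if T \subset A then T else T :\: A.
Proof.
move=> TB; rewrite argmax_map_in // /outside; case: ifP => TA.
  apply/setP => i; apply/argmaxP/idP => [[]//|iT]; split=> // j jT.
  by rewrite !(subsetP TA).
have [k kT kA] := subsetPn (negbT TA).
apply/setP => i; rewrite in_setD; apply/argmaxP/andP.
  case=> iT /(_ k kT); rewrite kA; case: (i \in A) => //=.
  by rewrite ler10.
by case=> iA iT; split=> // j jT; rewrite iA lern1 leq_b1.
Qed.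

(** The maximisers are subsets of [A] or of its complement, with [A] and its
    complement among them, so the dimension is [(#|A| - 1) + (#|~: A| - 1)]. *)
Lemma facet_is_facet A : A \in B -> A != [set: 'I_m]%SET ->
  is_facet (nestohedron R B) (facet A).
Proof.
move=> AB AT; have A0 : A != set0 by apply: contraNneq B0 => <-.
split.
  apply/is_face_nestohedron => //; exists (argmax_map (outside A) B) => //.
  exact: mem_argmax_maps.
rewrite affdim_nestohedron // affdim_faceof ?mem_argmax_maps // /cdim.
have nTA : ~~ ([set: 'I_m]%SET \subset A) by rewrite subTset.
have -> : (\sum_S dirs R (argmax_map (outside A) B S) = dirs R A + dirs R (~: A))%VS.
  apply/eqP; rewrite eqEsubv subv_add; apply/and3P; split.
  - apply/subv_sumP => S _; have [SB|SB] := boolP (S \in B); last first.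
      by rewrite argmax_map_out // dirs0 sub0v.
    rewrite argmax_map_outside //; case: ifP => SA.
      by apply: subv_trans (addvSl _ _); apply: dirsS.
    by apply: subv_trans (addvSr _ _); apply: dirsS; rewrite setDE subsetIr.
  - by apply: (sumv_sup A) => //; rewrite argmax_map_outside // subxx.
  - apply: (sumv_sup [set: 'I_m]%SET) => //.
    by rewrite argmax_map_outside // (negPf nTA) setTD.
rewrite dimv_disjoint_sum; last first.
  apply/eqP; rewrite -subv0; apply/subvP => v /memv_capP[/dirsP[v0 _] /dirsP[w0 _]].
  rewrite memv0; apply/eqP/rowP => i; rewrite mxE.
  have [iA|/v0 //] := boolP (i \in A); apply: w0.
  by rewrite inE negbK.
rewrite !dim_dirs.
have c1 : (0 < #|A|)%N by rewrite card_gt0.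
have c2 : (0 < #|~: A|)%N.
  by rewrite card_gt0; apply: contraNneq AT => e; rewrite -(setCK A) e setC0.
have := cardsC A; rewrite card_ord; lia.
Qed.

(** A common vertex: each summand is moved out of [A :|: A'] when possible.  A
    member [T] contained in [A :|: A'] lies in [A] or in [A'], since otherwise
    joining it to both would make [A :|: A'] a member. *)
Lemma facets_meet A A' : A \in B -> A' \in B -> [disjoint A & A'] ->
  A :|: A' \notin B -> exists x, facet A x /\ facet A' x.
Proof.
have B0' T : T \in B -> T != set0 by move=> TB; apply: contraNneq B0 => <-.
move=> AB AB' dA UB.
pose psi T := if T \subset A :|: A' then T else T :\: (A :|: A').
have psi0 T : T \in B -> psi T != set0.
  by move=> TB; rewrite /psi; case: ifP => [_|/negbT]; [exact: B0'|rewrite setD_eq0].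
have psiS T : psi T \subset T by rewrite /psi; case: ifP => // _; apply: subsetDl.
have inface A1 A2 : A1 \in B -> A2 \in B -> [disjoint A1 & A2] ->
    A1 :|: A2 = A :|: A' ->
    facet A1 (\sum_(T in B) vert R (psi T)).
  move=> A1B A2B d12 U12; exists (fun T => vert R (psi T)) => // T TB.
  have [k kT ->] := vertP R (psi0 T TB); split.
    by apply: simplex_vertex; apply: (subsetP (psiS T)).
  move=> i; apply: delta_out; rewrite argmax_map_outside //.
  case: ifP => TA1; first exact: (subsetP (psiS T)).
  move: kT; rewrite /psi; case: ifP => [TU kT|_]; last first.
    by rewrite -U12 !inE negb_or -andbA => /and3P[-> _ ->].
  rewrite inE kT andbT; apply: contraFN TA1 => kA1.
  apply: contraNT UB => TA1.
  have T1B : T :|: A1 \in B.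
    by apply: bB.2 => //; apply/negP => /disjointFr/(_ kT); rewrite kA1.
  have [j jT jA1] := subsetPn TA1.
  have jA2 : j \in A2 by have := subsetP TU j jT; rewrite -U12 inE (negPf jA1).
  rewrite -U12; have -> : A1 :|: A2 = (T :|: A1) :|: A2.
    by rewrite -setUA; apply/esym/setUidPr; rewrite U12.
  apply: bB.2 => //; apply/negP => /disjointFr/(_ (_ : j \in _)).
  by rewrite inE jT jA2 => /(_ isT).
exists (\sum_(T in B) vert R (psi T)); split.
  exact: (inface A A').
by apply: (inface A' A); rewrite // 1?disjoint_sym // setUC.
Qed.

(** For [S] without splitting, let [A] be a maximal proper member of [S] and
    consider the facets of [A] and of the maximal members of [S :\: A].  Two of
    these sets are disjoint and have no member as union, by maximality and
    because [S] does not split, so the facets meet.  At a common point of all of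
    them, the summand in the simplex on [S] would vanish on every one of these
    sets, which cover [S]. *)
Lemma flag_splitting : (forall i, [set i]%SET \in B) ->
  flag (nestohedron R B) -> splitting B.
Proof.
have B0' T : T \in B -> T != set0 by move=> TB; apply: contraNneq B0 => <-.
move=> B1 fP S SB S1; apply: contrapT => nosplit.
pose proper_in T := (T \in B) && (T \proper S).
have [i iS] : exists i, i \in S by apply/set0Pn; exact: B0'.
have pi : proper_in [set i]%SET.
  by rewrite /proper_in B1 properEcard sub1set iS cards1.
have [A /maxsetP[/andP[AB AS] Amax] iA] := maxset_exists pi.
pose rest T := (T \in B) && (T \subset S :\: A).
pose Q T := (T == A) || maxset rest T.
have restP T : maxset rest T -> [/\ T \in B, T \subset S :\: A &
    forall T', rest T' -> T \subset T' -> T' = T].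
  by move=> /maxsetP[/andP[TB TS] Tmax].
have QB T : Q T -> T \in B by move=> /orP[/eqP->//|/restP[]].
have nS T : Q T -> ~~ (S \subset T).
  move=> /orP[/eqP->|/restP[_ TS _]]; first by case/andP: AS.
  apply: contraNN (B0' A AB) => ST; rewrite -subset0; apply/subsetP => j jA.
  have /(subsetP (subset_trans ST TS)) := subsetP (proper_sub AS) j jA.
  by rewrite inE jA.
have QT T : Q T -> T != [set: 'I_m]%SET.
  by move=> /nS; apply: contraNneq => ->; apply: subsetT.
have disAT T : maxset rest T -> [disjoint A & T].
  move=> /restP[_ TS _]; rewrite disjoint_sym; apply: disjointWl TS _.
  by rewrite -setI_eq0 setDE -setIA [_ :&: A]setIC setICr setI0.
have unAT T : maxset rest T -> A :|: T \notin B.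
  move=> mT; have [TB TS Tmax] := restP T mT; apply/negP => UB.
  have US : A :|: T \subset S.
    by rewrite subUset (proper_sub AS) (subset_trans TS) ?subsetDl.
  have [UpS|] := boolP (A :|: T \proper S).
    have UA : A :|: T = A by apply: Amax; rewrite ?subsetUl // /proper_in UB.
    have TA : T \subset A by rewrite -UA subsetUr.
    by have := disAT T mT; rewrite -setI_eq0 (setIidPr TA) (negPf (B0' T TB)).
  rewrite properE US /= negbK => SU; apply: nosplit.
  by exists A, T; split=> //; [exact: disAT|apply/eqP; rewrite eqEsubset SU].
have unTT T T' : maxset rest T -> maxset rest T' -> T :|: T' \in B -> T = T'.
  move=> /restP[TB TS Tmax] /restP[T'B T'S T'max] UB.
  have rU : rest (T :|: T') by rewrite /rest UB subUset TS.
  by rewrite -(Tmax _ rU (subsetUl _ _)) -[RHS](T'max _ rU (subsetUr _ _)).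
have facets_pair T T' : Q T -> Q T' -> T != T' -> exists x, facet T x /\ facet T' x.
  move=> qT qT' TT'; have [TB TB'] := (QB T qT, QB T' qT').
  suff [dT nT] : [disjoint T & T'] /\ T :|: T' \notin B by exact: facets_meet.
  case/orP: qT TT' => [/eqP->|mT]; case/orP: qT' => [/eqP->|mT'].
  - by rewrite eqxx.
  - by rewrite disAT ?unAT.
  - by rewrite disjoint_sym setUC disAT ?unAT.
  move=> /eqP TT'; split; last by apply/negP => /(unTT _ _ mT mT').
  by apply: contraT => dT; case: TT'; apply: unTT => //; apply: bB.2.
have facet_ne T : facet T !=set0%classic.
  by eexists; apply: faceof_vert => //; apply: mem_argmax_maps.
have [] := fP [set facet T | T in [set T | Q T]]%classic.
- by move=> _ [T QTT <-]; apply: facet_is_facet; [exact: QB|exact: QT].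
- move=> _ _ [T qT <-] [T' qT' <-]; have [->|TT'] := eqVneq T T'.
    by have [x Fx] := facet_ne T'; exists x.
  by have [x []] := facets_pair T T' qT qT' TT'; exists x.
move=> x xF.
have xT T : Q T -> facet T x by move=> qT; apply: xF; exists T.
have [y yS xE] := xT A (predU1l _ erefl).
have ysimp T : T \in B -> simplex T (y T) by move=> /yS[].
have y0 T j : Q T -> j \in T -> y S 0 j = 0.
  move=> qT jT; have := xT T qT; rewrite /facet faceof_argmax_map // => -[_].
  rewrite xE => /(vmax_attained B0 ysimp) -/(_ S SB j); apply.
  by rewrite argmax_map_outside // (negPf (nS T qT)) inE jT.
have [_ ynS y1] := simplexP (ysimp S SB).
suff y_0 : \sum_j y S 0 j = 0 by move/eqP: y1; rewrite y_0 eq_sym oner_eq0.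
apply: big1 => j _.
have [jS|/ynS //] := boolP (j \in S).
have [jA|jA] := boolP (j \in A); first by apply: (y0 A) => //; rewrite /Q eqxx.
have rj : rest [set j]%SET by rewrite /rest B1 sub1set inE jA.
have [T mT jT] := maxset_exists rj.
by apply: (y0 T); rewrite ?/Q ?mT ?orbT // -sub1set.
Qed.

End FlagNestohedron.

Lemma gammaE (R : realType) (m : nat) (P : set 'rV[R]_m) (g : nat -> int) :
  is_gamma_vector P g -> gamma P = g.
Proof.
by move=> Pg; apply: xget_unique => // g' /is_gamma_vector_unique; apply.
Qed.

Theorem theorem3 (R : realType) (n : nat) (B1 B2 : {set {set 'I_n.+1}}) :
  connected_building_set B1 ->
  connected_building_set B2 ->
  B1 \subset B2 ->
  flag (nestohedron R B1) ->
  flag (nestohedron R B2) ->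
  forall i : nat, (i <= n./2)%N ->
    (gamma (nestohedron R B1) i <= gamma (nestohedron R B2) i)%R.
Proof.
have bE (B : {set {set 'I_n.+1}}) : building_set B -> building B.
  move=> [B0 _ BU]; split=> // A1 A2 A1B A2B d; apply: BU => //.
  by rewrite setI_eq0.
have tE (B : {set {set 'I_n.+1}}) :
    [set: 'I_n.+1]%SET \in B -> top B [set: 'I_n.+1]%SET.
  by move=> BT; split=> // A _; apply: subsetT.
move=> [c1 T1] [c2 T2] B12 f1 f2 i _.
have [b1 b2] := (bE _ c1, bE _ c2).
have s1 : splitting B1 by case: c1 => _ c1 _; exact: flag_splitting f1.
have s2 : splitting B2 by case: c2 => _ c2 _; exact: flag_splitting f2.
have [g [g0 gn gE]] := gammapos_hpol R b1 s1 (tE _ T1).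
have [d [d0 dn dE]] := gammapos_sub (fun D S _ => @gammapos_hpol R _ D S)
  b1 b2 s1 s2 B12 (tE _ T1) (tE _ T2).
have g1 : is_gamma_vector (nestohedron R B1) g.
  rewrite /is_gamma_vector affdim_nestohedron ?b1.1 // h_poly_nestohedron ?b1.1 //.
  by rewrite cardsT card_ord in gn gE.
have g2 : is_gamma_vector (nestohedron R B2) (fun j => g j + d j).
  rewrite /is_gamma_vector affdim_nestohedron ?b2.1 // h_poly_nestohedron ?b2.1 //.
  rewrite cardsT card_ord in gn gE dn dE; split.
    by move=> j jn; rewrite gn // dn // addr0.
  rewrite -(subrK (hpol R B1) (hpol R B2)) dE gE addrC -big_split /=.
  by apply: eq_bigr => j _; rewrite scalerDl.
by rewrite (gammaE g1) (gammaE g2) lerDl.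
Qed.
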